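(* Consider, for a sequence $n\to\infty$ with $p=p_n>n$ and $\log(p)/n=o(1)$, the linear model $Y=\mathbf{X}\beta^0+\varepsilon$ with Gaussian error $\varepsilon\sim\mathcal{N}_n(0,\sigma_\varepsilon^2I)$ independent of the random $n\times p$ design $\mathbf{X}$, where $\sigma_\varepsilon^2=\mathcal{O}(1)$. Assume that the rows of $\mathbf{X}$ are i.i.d. realizations from a Gaussian distribution whose $p$-dimensional inner product matrix $\Sigma$ has strictly positive smallest eigenvalue $\Lambda_{\min}^2$ satisfying $1/\Lambda_{\min}^2=\mathcal{O}(1)$, and that $\max_j\Sigma_{j,j}=\mathcal{O}(1)$. Assume $\beta^0\in\mathcal{B}(s_0)$ with $s_0=o(\sqrt n/\log(p))$, where $\mathcal{B}(s)=\{\beta\in\mathbb{R}^p: |\{j:\beta_j\ne0\}|\le s\}$, and suppose $\max_js_j=o(n/\log(p))$. Then, when using suitable choices $\lambda\asymp\sqrt{\log(p)/n}$ for the lasso $\hat\beta$ and $\lambda_j\asymp\sqrt{\log(p)/n}$ uniformly in $j$ for the nodewise lasso $\hat\Theta=\hat\Theta_{\mathrm{Lasso}}$, the estimator $\hat b_{\mathrm{Lasso}}=\hat\beta+\hat\Theta\mathbf{X}^T(Y-\mathbf{X}\hat\beta)/n$ satisfies $$\sqrt n(\hat b_{\mathrm{Lasso}}-\beta^0)=W+\Delta,$$ $$W|\mathbf{X}\sim\mathcal{N}_p(0,\sigma_\varepsilon^2\hat\Omega),\qquad\hat\Omega:=\hat\Theta\hat\Sigma\hat\Theta^T,$$ $$\|\Delta\|_\infty=o_{\mathbb{P}_{\beta^0}}(1)\quad\text{uniformly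 in }\beta^0\in\mathcal{B}(s_0).$$ Moreover, $\|\hat\Omega-\Sigma^{-1}\|_\infty=o_{\mathbb{P}}(1)$ (and $\hat\Omega$ does not depend on $\beta^0$).
   Context: All quantities may depend on $n$. $\mathbb{P}_{\beta^0}$ is the distribution of the data under the linear model with parameter $\beta^0$; ''$\|\Delta\|_\infty=o_{\mathbb{P}_{\beta^0}}(1)$ uniformly in $\beta^0\in\mathcal{B}(s_0)$'' means $\sup_{\beta^0\in\mathcal{B}(s_0)}\mathbb{P}_{\beta^0}(\|\Delta\|_\infty>\eta)\to0$ for every $\eta>0$. The inner product matrix is $\Sigma=\mathbb{E}[\mathbf{X}^T\mathbf{X}/n]$; $\hat\Sigma=\mathbf{X}^T\mathbf{X}/n$; $\Theta:=\Sigma^{-1}$; $s_j:=|\{k\ne j:\Theta_{j,k}\neq0\}|$. For a matrix $A$, $\|A\|_\infty=\max_{j,k}|A_{j,k}|$. ''Suitable choices'' means that there exist such parameters (not depending on $\beta^0$), bounded above and below by fixed positive constants (not depending on $n$ or $j$) times $\sqrt{\log(p)/n}$, for which the conclusion holds. Notation: $X_j$ is the $j$th column of $\mathbf{X}$ and $\mathbf{X}_{-j}$ is $\mathbf{X}$ without column $j$. Lasso: $\hat\beta:=\arg\min_{\beta\in\mathbb{R}^p}\left(\|Y-\mathbf{X}\beta\|_2^2/n+2\lambda\|\beta\|_1\right)$. Nodewise lasso: $\hat\gamma_j:=\arg\min_{\gamma\in\mathbb{R}^{p-1}}\left(\|X_j-\mathbf{X}_{-j}\gamma\|_2^2/n+2\lambda_j\|\gamma\|_1\right)$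 with components $\hat\gamma_{j,k}$, $k\ne j$; $\hat\tau_j^2:=\|X_j-\mathbf{X}_{-j}\hat\gamma_j\|_2^2/n+\lambda_j\|\hat\gamma_j\|_1$; $\hat C$ is the $p\times p$ matrix with $\hat C_{j,j}=1$, $\hat C_{j,k}=-\hat\gamma_{j,k}$ for $k\neq j$; $\hat T^2=\mathrm{diag}(\hat\tau_1^2,\dots,\hat\tau_p^2)$; $\hat\Theta_{\mathrm{Lasso}}:=\hat T^{-2}\hat C$. *)

(* Defs.v *)
From HB Require Import structures.
From mathcomp Require Import all_boot all_order all_algebra.
From mathcomp Require Import all_classical all_reals all_analysis.

Set Implicit Arguments.
Unset Strict Implicit.
Unset Printing Implicit Defensive.

Import Order.TTheory GRing.Theory Num.Theory.
Import numFieldNormedType.Exports.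

Local Open Scope classical_set_scope.
Local Open Scope ring_scope.

(* The Borel sigma-algebra on matrices, as the product sigma-algebra of the
   entries. *)
Section borel_matrix.
Context {R : realType} {m n : nat}.

Definition mx_coord_sets : set_system 'M[R]_(m, n) :=
  \bigcup_(ij in [set: 'I_m * 'I_n])
    preimage_set_system setT (fun A : 'M[R]_(m, n) => A ij.1 ij.2) measurable.

HB.instance Definition _ := @isMeasurable.Build (sigma_display mx_coord_sets)
  'M[R]_(m, n) <<s mx_coord_sets >> (@sigma_algebra0 _ setT mx_coord_sets)
  (@sigma_algebraC _ mx_coord_sets) (@sigma_algebra_bigcup _ setT mx_coord_sets).

End borel_matrix.

Section gaussian.
Context {R : realType}.

(* N(m, v) with variance v; the library's [normal_prob m 0] is the uniform
   distribution on [0, 1], so the degenerate case is treated apart. *)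
Definition normal_law (m v : R) : set R -> \bar R :=
  if v == 0 then \d_m else normal_prob m (Num.sqrt v).

(* nu = N_q(mu, V), possibly degenerate: V is a covariance matrix and every
   linear form t has the univariate law N(t mu, t V t^T) under nu. *)
Definition is_gaussian q (nu : set 'cV[R]_q -> \bar R) (mu : 'cV[R]_q)
    (V : 'M[R]_q) : Prop :=
  [/\ V^T = V,
      forall t : 'rV[R]_q, 0 <= (t *m V *m t^T) 0 0 &
      forall (t : 'rV[R]_q) (B : set R), measurable B ->
        pushforward nu (fun x : 'cV[R]_q => (t *m x) 0 0) B =
        normal_law ((t *m mu) 0 0) ((t *m V *m t^T) 0 0) B].

End gaussian.

Section independence.
Context {R : realType} {d d1 d2 : measure_display} {T : measurableType d}
  {T1 : measurableType d1} {T2 : measurableType d2} (P : probability T R).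

Definition independent_rv (X : T -> T1) (Y : T -> T2) : Prop :=
  forall (A : set T1) (B : set T2), measurable A -> measurable B ->
    P (X @^-1` A `&` Y @^-1` B) = (P (X @^-1` A) * P (Y @^-1` B))%E.

(* Subfamilies are covered by taking some of the B i to be setT. *)
Definition mutually_independent_rv (I : finType) (Z : I -> T -> T1) : Prop :=
  forall B : I -> set T1, (forall i, measurable (B i)) ->
    P (\bigcap_(i in [set: I]) (Z i @^-1` B i)) =
    (\prod_(i : I) P (Z i @^-1` B i))%E.

(* kappa is a regular version of the conditional distribution of W given X. *)
Definition conditional_distribution (X : T -> T1) (W : T -> T2)
    (kappa : R.-pker T1 ~> T2) : Prop :=
  forall (A : set T1) (B : set T2), measurable A -> measurable B ->
    P (X @^-1` A `&` W @^-1` B) = (\int[P]_(w in X @^-1` A) kappa (X w) B)%E.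

End independence.

Section design.
Context {R : realType} {d : measure_display} {T : measurableType d}
  (P : probability T R) {n p : nat}.

(* The mean of the rows is not assumed to vanish, so Sigma below is a second
   moment matrix. *)
Definition iid_gaussian_rows (X : T -> 'M[R]_(n, p)) : Prop :=
  mutually_independent_rv P (fun (i : 'I_n) w => row i (X w)) /\
  exists (mu : 'cV[R]_p) (V : 'M[R]_p), forall i : 'I_n,
    is_gaussian (pushforward P (fun w => (row i (X w))^T)) mu V.

Definition gram (x : 'M[R]_(n, p)) : 'M[R]_p := n%:R^-1 *: (x^T *m x).

Definition inner_product_mx (X : T -> 'M[R]_(n, p)) : 'M[R]_p :=
  \matrix_(j, k) fine ('E_P[fun w => gram (X w) j k])%E.

End design.

Definition smallest_eigenvalue {R : realType} q (A : 'M[R]_q) (a : R) : Prop :=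
  eigenvalue A a /\ forall b, eigenvalue A b -> a <= b.

Definition row_sparsity {R : realType} q (Theta : 'M[R]_q) (j : 'I_q) : nat :=
  #|[pred k | (k != j) && (Theta j k != 0)]|.

Definition sparse_ball {R : realType} q (s : nat) : set 'cV[R]_q :=
  [set b : 'cV[R]_q | (#|[pred j | b j ord0 != 0%R]| <= s)%N].

Section lasso.
Context {R : realType}.

Definition norm1 q (b : 'cV[R]_q) : R := \sum_j `|b j ord0|.
Definition sqnorm2 q (b : 'cV[R]_q) : R := \sum_j b j ord0 ^+ 2.

Definition is_lasso n q (lambda : R) (x : 'M[R]_(n, q)) (y : 'cV[R]_n)
    (b : 'cV[R]_q) : Prop :=
  forall b' : 'cV[R]_q,
    sqnorm2 (y - x *m b) / n%:R + 2 * lambda * norm1 b <=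
    sqnorm2 (y - x *m b') / n%:R + 2 * lambda * norm1 b'.

Context {n p : nat}.
Implicit Types (x : 'M[R]_(n, p)) (lambda : 'I_p -> R)
  (gamma : 'I_p -> 'cV[R]_p.-1).

(* The coordinate k of gamma j stands for column [lift j k] of x. *)
Definition is_nodewise_lasso lambda x gamma : Prop :=
  forall j, is_lasso (lambda j) (col' j x) (col j x) (gamma j).

Definition tau2 lambda x gamma (j : 'I_p) : R :=
  sqnorm2 (col j x - col' j x *m gamma j) / n%:R + lambda j * norm1 (gamma j).

Definition Chat gamma : 'M[R]_p :=
  \matrix_(j, k) if unlift j k is Some k' then - gamma j k' ord0 else 1.

Definition That2 lambda x gamma : 'M[R]_p :=
  diag_mx (\row_j tau2 lambda x gamma j).

Definition Theta_lasso lambda x gamma : 'M[R]_p :=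
  invmx (That2 lambda x gamma) *m Chat gamma.

Definition Omega_hat (Theta : 'M[R]_p) x : 'M[R]_p :=
  Theta *m gram x *m Theta^T.

Definition desparsified (Theta : 'M[R]_p) x (y : 'cV[R]_n) (b : 'cV[R]_p) :
    'cV[R]_p :=
  b + n%:R^-1 *: (Theta *m x^T *m (y - x *m b)).

End lasso.

(* Main.v *)
(** Write G for the Gram matrix of the design and c_j for the vector of
coefficients of the population residual of X_j regressed on the other columns,
so that c_j = Theta_j / Theta_jj and Sigma c_j = e_j / Theta_jj.  Squares of
Gaussian variables are subexponential, so a Chernoff bound for the quadratic
forms of G - Sigma at the vectors f_a + f_b and f_a - f_b, with f ranging over
the e_j and the c_j, shows by polarization that all the f_a^T (G - Sigma) f_b
are O(sqrt(log p / n)) with probability at least 1 - 16/p.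

On this event no restricted eigenvalue condition is needed for the nodewise
lasso: the slow rate makes the in-sample prediction error and lambda_j times
the l1-norm of gamma_j both of order sqrt(s_j log p / n), which tends to 0.
As Omega_jk is the normalized inner product of two nodewise residual vectors,
it is then uniformly close to Theta_jk.  For the lasso itself
s_0 sqrt(log p / n) tends to 0, so the entrywise bound on G - Sigma already
gives the compatibility condition and hence the l1-rate s_0 lambda; the KKT
conditions of the nodewise lasso bound the entries of Theta_hat G - I by
lambda_j / tau_j^2, and Delta is sqrt(n) times this matrix applied to the
lasso error. *)

(* The sparsities s_j may be of any order below n / log p, hence far larger than s_0, and the
   l1-norm of c_j is controlled only up to order sqrt(s_j). An entrywise bound on G - Sigma
   therefore says too little about (G - Sigma) c_j, which is why the c_j themselves enter the union
   bound. The forms at (e_k, c_j) with k different from j are the scores of the nodewise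
   regressions, because Sigma c_j vanishes off coordinate j. The forms at (c_j, c_k) compare the
   empirical Gram matrix of the population residuals with its mean.

   The rows need not be centred, so a linear form of a row has some mean m and variance v, and its
   natural scale is m^2 + v. Tying this scale to the second moment up to a constant is enough, and
   no constant is optimised. Each penalty is twice the bound on the corresponding score. *)
Require Import Defs.
From HB Require Import structures.
From mathcomp Require Import all_boot all_order all_algebra.
From mathcomp Require Import all_classical all_reals all_analysis.
From mathcomp Require Import measurable_realfun ring lra.

Set Implicit Arguments.
Unset Strict Implicit.
Unset Printing Implicit Defensive.

Import Order.TTheory GRing.Theory Num.Theory.
Import numFieldNormedType.Exports.

Local Open Scope classical_set_scope.
Local Open Scope ring_scope.

(** * Bilinear forms and the smallest eigenvalue *)

Section bilinear_forms.
Context {R : realType}.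

Definition bil q (A : 'M[R]_q) (u v : 'cV[R]_q) : R := (u^T *m A *m v) 0 0.

Definition dot q (u v : 'cV[R]_q) : R := \sum_j u j 0 * v j 0.

Context {q : nat}.
Implicit Types (A B : 'M[R]_q) (u v : 'cV[R]_q).

Lemma bilE A u v : bil A u v = \sum_j \sum_k u j 0 * A j k * v k 0.
Proof.
rewrite /bil mxE exchange_big /=; apply: eq_bigr => k _.
by rewrite mxE big_distrl /=; apply: eq_bigr => j _; rewrite mxE.
Qed.

Lemma bilDl A u v w : bil A (u + v) w = bil A u w + bil A v w.
Proof. by rewrite /bil linearD /= !mulmxDl mxE. Qed.

Lemma bilDr A u v w : bil A w (u + v) = bil A w u + bil A w v.
Proof. by rewrite /bil mulmxDr mxE. Qed.

Lemma bilNl A u v : bil A (- u) v = - bil A u v.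
Proof. by rewrite /bil linearN /= !mulNmx mxE. Qed.

Lemma bilNr A u v : bil A v (- u) = - bil A v u.
Proof. by rewrite /bil mulmxN mxE. Qed.

Lemma bilBl A u v w : bil A (u - v) w = bil A u w - bil A v w.
Proof. by rewrite bilDl bilNl. Qed.

Lemma bilBr A u v w : bil A w (u - v) = bil A w u - bil A w v.
Proof. by rewrite bilDr bilNr. Qed.

Lemma bilZl A a u v : bil A (a *: u) v = a * bil A u v.
Proof. by rewrite /bil linearZ /= -!scalemxAl mxE. Qed.

Lemma bilZr A a u v : bil A v (a *: u) = a * bil A v u.
Proof. by rewrite /bil -!scalemxAr mxE. Qed.

Lemma bilBm A B u v : bil (A - B) u v = bil A u v - bil B u v.
Proof. by rewrite /bil mulmxBr mulmxBl !mxE. Qed.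

Lemma bilC A u v : A^T = A -> bil A u v = bil A v u.
Proof.
move=> symA; rewrite /bil.
transitivity ((u^T *m A *m v)^T 0 0); first by rewrite [RHS]mxE.
by rewrite !trmx_mul trmxK symA mulmxA.
Qed.

Lemma bil_delta A j k : bil A (delta_mx j 0) (delta_mx k 0) = A j k.
Proof. by rewrite /bil trmx_delta -rowE -colE !mxE. Qed.

Lemma bil_polar A u v : A^T = A ->
  bil A u v = (bil A (u + v) (u + v) - bil A (u - v) (u - v)) / 4.
Proof.
move=> symA; rewrite !(bilDl, bilDr, bilNl, bilNr) (bilC v u symA); lra.
Qed.

Lemma dotC u v : dot u v = dot v u.
Proof. by apply: eq_bigr => j _; rewrite mulrC. Qed.

Lemma dotDl u v w : dot (u + v) w = dot u w + dot v w.
Proof. by rewrite -big_split /=; apply: eq_bigr => j _; rewrite mxE mulrDl. Qed.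

Lemma dotNl u v : dot (- u) v = - dot u v.
Proof. by rewrite -sumrN; apply: eq_bigr => j _; rewrite mxE mulNr. Qed.

Lemma dotZl a u v : dot (a *: u) v = a * dot u v.
Proof. by rewrite mulr_sumr; apply: eq_bigr => j _; rewrite mxE mulrA. Qed.

Lemma dotDr u v w : dot w (u + v) = dot w u + dot w v.
Proof. by rewrite dotC dotDl !(dotC w). Qed.

Lemma dotNr u v : dot v (- u) = - dot v u.
Proof. by rewrite dotC dotNl dotC. Qed.

Lemma dotZr a u v : dot v (a *: u) = a * dot v u.
Proof. by rewrite dotC dotZl dotC. Qed.

Lemma dot_sqnorm2 u : dot u u = sqnorm2 u.
Proof. by apply: eq_bigr => j _; rewrite expr2. Qed.

Lemma dot_mx u v : dot u v = (u^T *m v) 0 0.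
Proof. by rewrite mxE; apply: eq_bigr => j _; rewrite mxE. Qed.

Lemma sqnorm2_ge0 u : 0 <= sqnorm2 u.
Proof. by apply: sumr_ge0 => j _; exact: sqr_ge0. Qed.

Lemma norm1_ge0 u : 0 <= norm1 u.
Proof. by apply: sumr_ge0. Qed.

Lemma norm1N u : norm1 (- u) = norm1 u.
Proof. by apply: eq_bigr => j _; rewrite mxE normrN. Qed.

Lemma ler_norm1D u v : norm1 (u + v) <= norm1 u + norm1 v.
Proof.
by rewrite -big_split /=; apply: ler_sum => j _; rewrite mxE ler_normD.
Qed.

Lemma norm1Z a u : norm1 (a *: u) = `|a| * norm1 u.
Proof. by rewrite mulr_sumr; apply: eq_bigr => j _; rewrite mxE normrM. Qed.

Lemma sqr_coord_le_sqnorm2 u j : u j 0 ^+ 2 <= sqnorm2 u.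
Proof.
by rewrite /sqnorm2 (bigD1 j) //= lerDl sumr_ge0 // => k _; exact: sqr_ge0.
Qed.

Lemma sqnorm2_eq0 u : (sqnorm2 u == 0) = (u == 0).
Proof.
apply/eqP/eqP => [u0|->]; last first.
  by rewrite /sqnorm2 big1 // => j _; rewrite mxE expr0n.
apply/colP => j; rewrite mxE; apply/eqP; rewrite -sqrf_eq0.
by rewrite eq_le sqr_ge0 andbT -u0 sqr_coord_le_sqnorm2.
Qed.

Lemma dot_le_norm1 u v a : (forall j, `|u j 0| <= a) -> `|dot u v| <= a * norm1 v.
Proof.
move=> ua; apply: le_trans (ler_norm_sum _ _ _) _; rewrite mulr_sumr.
by apply: ler_sum => j _; rewrite normrM ler_wpM2r.
Qed.

Lemma bil_le_norm1 A u v a : (forall j k, `|A j k| <= a) ->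
  `|bil A u v| <= a * norm1 u * norm1 v.
Proof.
move=> Aa; rewrite bilE; apply: le_trans (ler_norm_sum _ _ _) _.
rewrite mulrAC mulr_sumr; apply: ler_sum => j _.
apply: le_trans (ler_norm_sum _ _ _) _.
rewrite -mulrA mulr_suml mulr_sumr; apply: ler_sum => k _; rewrite !normrM.
by rewrite [`|u j 0| * _]mulrC -mulrA [`|v k 0| * _]mulrC ler_wpM2r ?mulr_ge0.
Qed.

(** Cauchy-Schwarz against the indicator of [S]. The deviations of [|u j 0|] from their mean over
    [S], scaled by the cardinality [c], have a nonnegative sum of squares. *)
Lemma norm1_sqr_le (S : pred 'I_q) u :
  (\sum_(j | S j) `|u j 0|) ^+ 2 <= #|S|%:R * sqnorm2 u.
Proof.
set c := #|S|%:R; set a : R := \sum_(j | S j) _.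
have [S0|S0] := posnP #|S|.
  rewrite /c S0 mul0r /a big_pred0 ?expr0n // => j.
  by have := card0_eq S0 j.
have c0 : 0 < c by rewrite ltr0n.
have : 0 <= \sum_(j | S j) (c * `|u j 0| - a) ^+ 2.
  by apply: sumr_ge0 => j _; exact: sqr_ge0.
have -> : \sum_(j | S j) (c * `|u j 0| - a) ^+ 2 =
   c * (c * \sum_(j | S j) u j 0 ^+ 2 - a ^+ 2).
  under eq_bigr => j _ do rewrite sqrrB exprMn real_normK ?num_real //.
  rewrite big_split sumrB /= -!mulr_sumr sumr_const.
  have -> : \sum_(j | S j) c * `|u j 0| * a *+ 2 = 2 * c * a ^+ 2.
    rewrite sumrMnl -mulr_suml -mulr_sumr -/a; ring.
  rewrite -[_ *+ #|_|]mulr_natr -/c; ring.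
rewrite pmulr_rge0 // subr_ge0 => /le_trans; apply.
rewrite ler_pM2l // /sqnorm2 [leRHS](bigID S) /= lerDl.
by apply: sumr_ge0 => j _; exact: sqr_ge0.
Qed.

(** Expand the squared norm of [h *: u + s *: v] for [s] equal to 1 and to -1. The free weight [h]
    is meant for pairs in which [u] is merely bounded while [v] is small. *)
Lemma young_dot u v h : 0 < h ->
  `|dot u v| <= (h * sqnorm2 u + h^-1 * sqnorm2 v) / 2.
Proof.
move=> h0; have hV : h * h^-1 = 1 by rewrite divff // gt_eqF.
have H s : s ^+ 2 = 1 ->
    0 <= h * sqnorm2 u + h^-1 * sqnorm2 v + 2 * s * dot u v.
  move=> s1; have := sqnorm2_ge0 (h *: u + s *: v).
  rewrite -dot_sqnorm2 !(dotDl, dotDr, dotZl, dotZr) (dotC v u) !dot_sqnorm2.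
  have hi0 : 0 < h^-1 by rewrite invr_gt0.
  move=> /(mulr_ge0 (ltW hi0)); congr (_ <= _).
  transitivity ((h * h^-1) * h * sqnorm2 u + 2 * s * (h * h^-1) * dot u v
       + h^-1 * (s ^+ 2) * sqnorm2 v); first by ring.
  rewrite hV s1; ring.
rewrite ler_norml; have := H 1; have := H (-1).
rewrite sqrrN expr1n; move=> /(_ erefl) ? /(_ erefl) ?; apply/andP; split; lra.
Qed.

End bilinear_forms.

Section smallest_eigenvalue.
Context {R : realType} {q : nat}.

Lemma continuous_bil (A : 'M[R]_q) : continuous (fun v : 'rV[R]_q => bil A v^T v^T).
Proof.
rewrite (_ : (fun v => _) =
  \sum_j \sum_k (fun v : 'rV[R]_q => v 0 j * A j k * v 0 k)); last first.
  apply/funext => v; rewrite bilE fct_sumE; apply: eq_bigr => j _.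
  by rewrite fct_sumE; apply: eq_bigr => k _; rewrite !mxE.
have cs (f : 'I_q -> 'rV[R]_q -> R) : (forall j, continuous (f j)) ->
    continuous (\sum_j f j).
  move=> cf; elim/big_ind : _ => // [v|g h cg ch v].
    exact: (@cst_continuous _ _ (0 : R) v).
  exact: (cvgD (cg v) (ch v)).
apply: (cs) => j; apply: (cs) => k v.
have cc i : {for v, continuous (fun w : 'rV[R]_q => w 0 i)}.
  exact: coord_continuous.
by apply: (continuousM (continuousM (cc j) _) (cc k)); exact: cst_continuous.
Qed.

(* The minimum of the quadratic form on the unit sphere is attained, and a
   minimiser is an eigenvector by the first-order condition. *)
Lemma smallest_eigenvalue_le (A : 'M[R]_q) a (v : 'cV[R]_q) : A^T = A ->
  smallest_eigenvalue A a -> a * sqnorm2 v <= bil A v v.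
Proof.
move=> symA [eva amin].
have bil1 (u : 'cV[R]_q) : bil 1%:M u u = sqnorm2 u.
  by rewrite /bil mulmx1 -dot_sqnorm2 dot_mx.
pose S := [set u : 'rV[R]_q | sqnorm2 u^T = 1].
have normalize (u : 'cV[R]_q) : u != 0 ->
    exists2 c : R, 0 < c & c ^+ 2 * sqnorm2 u = 1.
  move=> u0; have s0 : 0 < sqnorm2 u.
    by rewrite lt_neqAle sqnorm2_ge0 eq_sym sqnorm2_eq0 u0.
  exists (Num.sqrt (sqnorm2 u))^-1; first by rewrite invr_gt0 sqrtr_gt0.
  by rewrite exprVn sqr_sqrtr ?sqnorm2_ge0 // mulVf // gt_eqF.
have sqZ (c : R) (u : 'cV[R]_q) : sqnorm2 (c *: u) = c ^+ 2 * sqnorm2 u.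
  by rewrite -!bil1 bilZl bilZr mulrA expr2.
have S0 : S !=set0.
  have /eigenvalueP[u _ u0] := eva.
  have [|c c0 cu] := normalize u^T; first by rewrite trmx_eq0.
  by exists (c *: u); rewrite /S /= linearZ /= sqZ.
have cS : compact S.
  apply: bounded_closed_compact.
    exists 1; split => // x x1 u uS; apply: le_trans (ltW x1).
    rewrite [leLHS]mx_normrE; apply/bigmax_leP; split => // -[i j] _.
    rewrite ord1 /= -[leRHS](normr1) -ler_sqr ?nnegrE // !real_normK ?num_real //.
    by rewrite expr1n -uS -[leLHS](_ : u^T j 0 ^+ 2 = _) ?sqr_coord_le_sqnorm2 // mxE.
  have -> : S = (fun u : 'rV[R]_q => bil 1%:M u^T u^T) @^-1` [set 1].
    by apply/seteqP; split => u /=; rewrite bil1.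
  apply: closed_comp; last exact: closed_eq.
  by move=> u _; exact: continuous_bil.
have [u] := EVT_min_rV S0 cS (continuous_subspaceT (@continuous_bil A)).
rewrite inE => uS umin.
set m := bil A u^T u^T in umin.
have mle w : m * sqnorm2 w <= bil A w w.
  have [->|w0] := eqVneq w 0.
    by rewrite /sqnorm2 big1 ?mulr0 ?/bil ?mulmx0 ?mxE // => j _; rewrite mxE expr0n.
  have [c c0 cw] := normalize _ w0.
  have := umin (c *: w)^T; rewrite trmxK inE; move=> /(_ _)/wrap[].
    by rewrite /S /= trmxK sqZ.
  rewrite bilZl bilZr mulrA -expr2 => h.
  rewrite -(ler_pM2l (_ : 0 < c ^+ 2)) ?exprn_gt0 //.
  by rewrite mulrCA cw mulr1.
apply: le_trans (mle v); rewrite ler_wpM2r ?sqnorm2_ge0 //; apply: amin.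
apply/eigenvalueP; exists u; last first.
  apply/eqP => u0; move: uS; rewrite /S /= u0 /sqnorm2 big1.
    by move/eqP; rewrite eq_sym oner_eq0.
  by move=> j _; rewrite !mxE expr0n.
(* Half the gradient at [u] of [bil A w w - m * sqnorm2 w], a function of [w] that is nonnegative
   and vanishes at [u]. If it were nonzero, moving against it would make the function negative. *)
pose g : 'cV[R]_q := A *m u^T - m *: u^T.
suff : g = 0.
  move/subr0_eq => /(congr1 trmx); rewrite trmx_mul linearZ /= trmxK.
  by rewrite symA.
have dg : bil A g u^T - m * dot g u^T = sqnorm2 g.
  rewrite -dot_sqnorm2 {4}/g dotDr dotNr dotZr; congr (_ - _).
  by rewrite /bil dot_mx mulmxA.
clearbody g.
have key t : 0 <= t ^+ 2 * (bil A g g - m * sqnorm2 g) - 2 * t * sqnorm2 g.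
  have := mle (u^T - t *: g); rewrite -subr_ge0.
  rewrite -dot_sqnorm2 !(bilDl, bilDr, bilNl, bilNr, bilZl, bilZr,
    dotDl, dotDr, dotNl, dotNr, dotZl, dotZr) (bilC u^T g symA) (dotC u^T g).
  rewrite !dot_sqnorm2 -/m (uS : sqnorm2 u^T = 1).
  move: dg; set x := bil A g u^T; set y := dot g u^T => dg.
  by rewrite -dg; congr (_ <= _); ring.
apply/eqP; rewrite -sqnorm2_eq0 eq_le sqnorm2_ge0 andbT leNgt; apply/negP => g0.
set b := bil A g g - _ in key.
(* Small enough that [t * |b|] stays below [sqnorm2 g], so the linear term of [key] wins. *)
pose t := sqnorm2 g / (`|b| + sqnorm2 g).
have d0 : 0 < `|b| + sqnorm2 g by rewrite ltr_wpDl.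
have t0 : 0 < t by rewrite divr_gt0.
have := key t; rewrite leNgt => /negP; apply.
have -> : t ^+ 2 * b - 2 * t * sqnorm2 g = t * (t * b - 2 * sqnorm2 g) by ring.
rewrite pmulr_rlt0 // subr_lt0.
apply: (@le_lt_trans _ _ (sqnorm2 g)); last lra.
apply: (@le_trans _ _ (t * `|b|)); first by rewrite ler_pM2l // ler_norm.
rewrite /t mulrAC ler_pdivrMr // ler_pM2l //; lra.
Qed.

End smallest_eigenvalue.

(** * Deterministic theory of the lasso *)

Section lasso_theory.
Context {R : realType}.

(** First-order condition at 0 for a parabola plus a kink [c |t|]: the slope cannot exceed that of
    the kink. It stands in for subdifferentials of the l1-norm in the KKT conditions. The range
    [|t| <= 1] is what the perturbation of [b] into [(1 + t) b] allows, since [1 + t] must be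
    nonnegative. *)
Lemma quadratic_slope_le (a b c : R) : 0 <= b ->
  (forall t, `|t| <= 1 -> 0 <= t ^+ 2 * b - t * a + `|t| * c) -> `|a| <= c.
Proof.
move=> b0 h; rewrite leNgt; apply/negP => ca.
have e0 : 0 < `|a| - c by rewrite subr_gt0.
set e := `|a| - c in e0.
have d0 : 0 < b + e by rewrite ltr_wpDl.
pose s := e / (b + e).
have s0 : 0 < s by rewrite divr_gt0.
have s1 : s <= 1 by rewrite ler_pdivrMr // mul1r lerDr.
have [g g1 ga] : exists2 g : R, `|g| = 1 & g * a = `|a|.
  have [a0|a0] := leP 0 a.
    by exists 1; rewrite ?normr1 // mul1r ger0_norm.
  by exists (-1); rewrite ?normrN1 // mulN1r ltr0_norm.
have sg : `|s * g| = s by rewrite normrM g1 mulr1 gtr0_norm.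
have := h (s * g); rewrite sg => /(_ s1).
have -> : (s * g) ^+ 2 = s ^+ 2 by rewrite -real_normK ?num_real // sg.
have -> : s ^+ 2 * b - s * g * a + s * c = s * (s * b - e).
  rewrite -[s * g * a]mulrA ga /e; ring.
rewrite pmulr_rge0 // subr_ge0 leNgt => /negP; apply.
rewrite /s mulrAC ltr_pdivrMr // mulrDr ltrDl; exact: mulr_gt0.
Qed.

Lemma sqnorm2B n (u v : 'cV[R]_n) :
  sqnorm2 (u - v) = sqnorm2 u - 2 * dot u v + sqnorm2 v.
Proof.
rewrite -!dot_sqnorm2 !(dotDl, dotDr, dotNl, dotNr) (dotC v u); ring.
Qed.

Lemma dot_mulmxr n q (x : 'M[R]_(n, q)) (u : 'cV[R]_n) (v : 'cV[R]_q) :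
  dot u (x *m v) = dot (x^T *m u) v.
Proof. by rewrite !dot_mx trmx_mul trmxK mulmxA. Qed.

Lemma dot_delta q (u : 'cV[R]_q) k : dot u (delta_mx k 0) = u k 0.
Proof.
rewrite /dot (bigD1 k) //= mxE !eqxx mulr1 big1 ?addr0 // => j jk.
by rewrite mxE (negbTE jk) mulr0.
Qed.

Lemma norm1_delta q (k : 'I_q) : norm1 (delta_mx k 0 : 'cV[R]_q) = 1.
Proof.
rewrite /norm1 (bigD1 k) //= mxE !eqxx normr1 big1 ?addr0 // => j jk.
by rewrite mxE (negbTE jk) normr0.
Qed.

Context {n q : nat}.
Implicit Types (x : 'M[R]_(n, q)) (y : 'cV[R]_n) (b d : 'cV[R]_q).
Lemma lasso_perturb lambda x y b d : is_lasso lambda x y b ->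
  0 <= (sqnorm2 (x *m d) - 2 * dot (y - x *m b) (x *m d)) / n%:R
       + 2 * lambda * (norm1 (b + d) - norm1 b).
Proof.
move=> /(_ (b + d)); rewrite mulmxDr opprD addrA (sqnorm2B _ (x *m d)) -subr_ge0.
congr (_ <= _); ring.
Qed.

Lemma lasso_KKT lambda x y b k : 0 <= lambda -> is_lasso lambda x y b ->
  `|(x^T *m (y - x *m b)) k 0 / n%:R| <= lambda.
Proof.
move=> l0 lb; set r := y - _.
suff : `|2 * ((x^T *m r) k 0 / n%:R)| <= 2 * lambda.
  by rewrite normrM ger0_norm // ler_pM2l.
apply: (@quadratic_slope_le _ (sqnorm2 (x *m delta_mx k 0) / n%:R)).
  by rewrite divr_ge0 ?sqnorm2_ge0.
move=> t _; apply: le_trans (lasso_perturb (t *: delta_mx k 0) lb) _.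
have : norm1 (b + t *: delta_mx k 0) - norm1 b <= `|t|.
  rewrite lerBlDl; apply: le_trans (ler_norm1D _ _) _.
  by rewrite norm1Z norm1_delta mulr1.
move=> /(ler_wpM2l (mulr_ge0 (ler0n R 2) l0)).
rewrite -scalemxAr dotZr -dot_sqnorm2 dotZl dotZr dot_sqnorm2 dot_mulmxr dot_delta.
rewrite -/r; set s := sqnorm2 _; set u := (_ *m r) k 0 => h.
have -> : t ^+ 2 * (s / n%:R) - t * (2 * (u / n%:R)) + `|t| * (2 * lambda) =
  (t * (t * s) - 2 * (t * u)) / n%:R + 2 * lambda * `|t| by ring.
by rewrite lerD2l.
Qed.

(** Perturb along [b] itself: the penalty is then exactly linear in [t], so there is no kink and the
    slope must vanish. This sums the KKT equalities over the active set without naming it. *)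
Lemma lasso_KKT_active lambda x y b : 0 <= lambda -> is_lasso lambda x y b ->
  dot (y - x *m b) (x *m b) / n%:R = lambda * norm1 b.
Proof.
move=> l0 lb; set r := y - _.
apply/eqP; rewrite -subr_eq0 -normr_le0 -(pmulr_rle0 _ (ltr0n R 2)).
rewrite -[X in X * _]ger0_norm // -normrM.
apply: (@quadratic_slope_le _ (sqnorm2 (x *m b) / n%:R)).
  by rewrite divr_ge0 ?sqnorm2_ge0.
move=> t t1; apply: le_trans (lasso_perturb (t *: b) lb) _.
have -> : norm1 (b + t *: b) = (1 + t) * norm1 b.
  rewrite -{1}[b]scale1r -scalerDl norm1Z ger0_norm //.
  by move: t1; rewrite ler_norml => /andP[]; lra.
rewrite -/r -scalemxAr dotZr -dot_sqnorm2 dotZl dotZr dot_sqnorm2.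
by rewrite le_eqVlt; apply/orP; left; apply/eqP; ring.
Qed.

(** The basic inequality, from comparing the objective at [b] and at [b0]. The cross term occurs
    twice, so a score bound of [lambda / 2] leaves [lambda * norm1 (b - b0)]. *)
Lemma lasso_basic lambda x y b b0 : 0 <= lambda -> is_lasso lambda x y b ->
  (forall k, `|(x^T *m (y - x *m b0)) k 0 / n%:R| <= lambda / 2) ->
  `|dot (y - x *m b0) (x *m (b - b0)) / n%:R| <= lambda / 2 * norm1 (b - b0) /\
  sqnorm2 (x *m (b - b0)) / n%:R + 2 * lambda * norm1 b <=
  lambda * norm1 (b - b0) + 2 * lambda * norm1 b0.
Proof.
move=> l0 lb hk.
have H : `|dot (y - x *m b0) (x *m (b - b0)) / n%:R| <= lambda / 2 * norm1 (b - b0).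
  rewrite dot_mulmxr mulrC -dotZl; apply: dot_le_norm1 => k.
  by rewrite mxE mulrC.
split => //.
have := lb b0; have -> : y - x *m b = (y - x *m b0) - x *m (b - b0).
  by rewrite mulmxBr opprB addrA subrK.
rewrite sqnorm2B; move: H; set D := dot _ _; set S := sqnorm2 (x *m _).
rewrite ler_norml => /andP[_ DN].
rewrite [(_ - _ + S) / _]mulrDl mulrBl -mulrA; lra.
Qed.

(** The triangle inequality for [norm1 (b - b0)] lets one copy of [lambda * norm1 b] be absorbed on
    the left of the basic inequality, which leaves three copies of [lambda * norm1 b0] on the
    right. *)
Lemma lasso_slow_rate lambda x y b b0 : 0 <= lambda -> is_lasso lambda x y b ->
  (forall k, `|(x^T *m (y - x *m b0)) k 0 / n%:R| <= lambda / 2) ->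
  [/\ sqnorm2 (x *m (b - b0)) / n%:R <= 3 * (lambda * norm1 b0),
      lambda * norm1 b <= 3 * (lambda * norm1 b0) &
      `|dot (y - x *m b0) (x *m (b - b0)) / n%:R| <= 2 * (lambda * norm1 b0)].
Proof.
move=> l0 lb /(lasso_basic l0 lb)[+ h].
have : lambda * norm1 (b - b0) <= lambda * norm1 b + lambda * norm1 b0.
  by rewrite -mulrDr ler_wpM2l // -(norm1N b0) ler_norm1D.
have S0 : 0 <= sqnorm2 (x *m (b - b0)) / n%:R by rewrite divr_ge0 ?sqnorm2_ge0.
have N0 : 0 <= lambda * norm1 b by rewrite mulr_ge0 ?norm1_ge0.
rewrite mulrAC => hd D; split; lra.
Qed.

Lemma bil_gram x (u v : 'cV[R]_q) :
  bil (gram x) u v = dot (x *m u) (x *m v) / n%:R.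
Proof.
rewrite /bil /gram -scalemxAr -scalemxAl mxE dot_mx mulrC.
by rewrite trmx_mul !mulmxA.
Qed.

(** With [a] and [c] the l1-masses of the error on and off the support of [b0], the basic inequality
    gives the cone condition [c <= 3 * a], so [norm1 d <= 4 * a]. Passing from [Sig] to the Gram
    matrix then costs at most [16 * kappa * a ^+ 2], which is half of the curvature [L * sqnorm2 d].
    Together with [a ^+ 2 <= s * sqnorm2 d] this yields [a <= 6 * lambda * s / L], and the factor 4
    makes 24. *)
Lemma lasso_l1_error lambda x y b b0 (s : nat) (Sig : 'M[R]_q) kappa L :
  0 < lambda -> 0 < L -> 0 <= kappa -> is_lasso lambda x y b ->
  (forall k, `|(x^T *m (y - x *m b0)) k 0 / n%:R| <= lambda / 2) ->
  sparse_ball s b0 ->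
  (forall v, L * sqnorm2 v <= bil Sig v v) ->
  (forall j k, `|(gram x - Sig) j k| <= kappa) ->
  16 * kappa * s%:R <= L / 2 ->
  norm1 (b - b0) <= 24 * lambda * s%:R / L.
Proof.
move=> l0 L0 k0 lb hk sb hL hkap hs.
have [_ h] := lasso_basic (ltW l0) lb hk.
set d := b - b0 in h *.
pose S := [pred j | b0 j ord0 != 0%R].
pose a := \sum_(j | S j) `|d j 0|.
pose c := \sum_(j | ~~ S j) `|d j 0|.
have a0 : 0 <= a by apply: sumr_ge0.
have c0 : 0 <= c by apply: sumr_ge0.
have dac : norm1 d = a + c by rewrite /norm1 (bigID S).
have b0S : norm1 b0 = \sum_(j | S j) `|b0 j 0|.
  rewrite /norm1 (bigID S) /= [X in _ + X]big1 ?addr0 // => j.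
  by rewrite negbK => /eqP ->; rewrite normr0.
have hb : norm1 b0 - a + c <= norm1 b.
  rewrite /norm1 -/(norm1 b0) b0S [leRHS](bigID S) /= lerD //.
    rewrite -sumrB; apply: ler_sum => j _.
    have {1}-> : b0 j 0 = b j 0 - d j 0 by rewrite !mxE; ring.
    by rewrite lerBlDr ler_normB.
  apply: ler_sum => j; rewrite negbK => /eqP bj.
  by rewrite !mxE bj subr0.
have S0 : 0 <= sqnorm2 (x *m d) / n%:R by rewrite divr_ge0 ?sqnorm2_ge0.
have hac : sqnorm2 (x *m d) / n%:R + lambda * c <= 3 * (lambda * a).
  have := ler_wpM2l (ltW l0) hb; rewrite mulrDr mulrBr.
  by move: h; rewrite dac mulrDr => h ?; lra.
have c3a : c <= 3 * a.
  by rewrite -(ler_pM2l l0); lra.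
have D0 := sqnorm2_ge0 d.
have aD : a ^+ 2 <= s%:R * sqnorm2 d.
  apply: le_trans (norm1_sqr_le S d) _.
  by rewrite ler_wpM2r // ler_nat; exact: sb.
have hDa : L / 2 * sqnorm2 d <= 3 * (lambda * a).
  have e1 : `|bil (gram x - Sig) d d| <= 16 * kappa * a ^+ 2.
    apply: le_trans (bil_le_norm1 _ _ hkap) _.
    rewrite -mulrA [16 * _]mulrC -mulrA ler_wpM2l //.
    have : norm1 d <= 4 * a by lra.
    have := norm1_ge0 d; nra.
  have e2 : 16 * kappa * a ^+ 2 <= L / 2 * sqnorm2 d.
    apply: (@le_trans _ _ (16 * kappa * (s%:R * sqnorm2 d))).
      by rewrite ler_wpM2l // mulr_ge0.
    by rewrite mulrA ler_wpM2r.
  have := hL d; move: e1; rewrite ler_norml bilBm bil_gram dot_sqnorm2.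
  have := mulr_ge0 (ltW l0) c0; move=> ? /andP[e1 _] ?; lra.
have a6 : a <= 6 * lambda * s%:R / L.
  have [->|an0] := eqVneq a 0.
    by rewrite divr_ge0 ?(ltW L0) // !mulr_ge0 // ltW.
  have ap : 0 < a by rewrite lt_neqAle eq_sym an0.
  rewrite ler_pdivlMr // -(ler_pM2r ap).
  have s0 : 0 <= s%:R :> R by [].
  have := ler_wpM2l s0 hDa; have := ler_wpM2l (ltW L0) aD.
  set D := sqnorm2 d; nra.
rewrite dac; apply: (@le_trans _ _ (4 * a)); first lra.
have -> : 24 * lambda * s%:R / L = 4 * (6 * lambda * s%:R / L) by ring.
by rewrite ler_pM2l.
Qed.

End lasso_theory.

(** * The nodewise lasso *)

Section nodewise_lasso.
Context {R : realType} {n p : nat}.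
Implicit Types (x : 'M[R]_(n, p)) (j k : 'I_p).

(* The residual of the j-th nodewise regression with coefficients g is
   x *m nodewise_dir j g. *)
Definition nodewise_dir j (g : 'cV[R]_p.-1) : 'cV[R]_p :=
  \col_k if unlift j k is Some k' then - g k' 0 else 1.

Lemma mulmx_nodewise_dir x j (g : 'cV[R]_p.-1) :
  x *m nodewise_dir j g = col j x - col' j x *m g.
Proof.
apply/colP => i; rewrite !mxE (bigD1_ord j) //= mxE unlift_none mulr1.
by rewrite -sumrN; congr (_ + _); apply: eq_bigr => k _; rewrite !mxE liftK mulrN.
Qed.

Lemma Chat_nodewise_dir (gamma : 'I_p -> 'cV[R]_p.-1) j k :
  Chat gamma j k = nodewise_dir j (gamma j) k 0.
Proof. by rewrite !mxE. Qed.

Lemma invmx_diag (d : 'rV[R]_p) : (forall j, d 0 j != 0) ->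
  invmx (diag_mx d) = diag_mx (\row_j (d 0 j)^-1).
Proof.
move=> d0; set e := diag_mx (\row_j _).
have ed : e *m diag_mx d = 1%:M.
  rewrite mulmx_diag -diag_const_mx; congr diag_mx.
  by apply/rowP => j; rewrite !mxE mulVf.
by rewrite -[LHS]mul1mx -ed -mulmxA mulmxV ?mulmx1 //; have [] := mulmx1_unit ed.
Qed.

(** [invmx] returns its argument when it is singular, whence the second branch. Having an explicit
    formula in both cases is what makes the estimator measurable on all designs. *)
Lemma Theta_lassoE (lambda : 'I_p -> R) x gamma j k :
  Theta_lasso lambda x gamma j k =
  (if [forall i, tau2 lambda x gamma i != 0] then (tau2 lambda x gamma j)^-1
   else tau2 lambda x gamma j) * nodewise_dir j (gamma j) k 0.
Proof.
rewrite /Theta_lasso /That2 -Chat_nodewise_dir; case: ifPn => [/forallP t0|t0].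
  rewrite invmx_diag => [|i]; last by rewrite mxE.
  by rewrite mul_diag_mx !mxE.
rewrite invmx_out; first by rewrite mul_diag_mx !mxE.
rewrite inE unitmxE det_diag unitfE prodf_seq_neq0 -big_all big_all.
apply: contra t0 => /allP h; apply/forallP => i; have := h i.
by rewrite mem_index_enum mxE; apply.
Qed.

Lemma mulmx_gram_delta x (h : 'cV[R]_p) k :
  (x^T *m (x *m h)) k 0 / n%:R = bil (gram x) (delta_mx k 0) h.
Proof. by rewrite bil_gram dotC dot_mulmxr dot_delta. Qed.

End nodewise_lasso.

(** * Population nodewise regression *)

Section population.
Context {R : realType} {p : nat}.
Variables (Sig : 'M[R]_p) (L M : R).
Hypotheses (symS : Sig^T = Sig) (L0 : 0 < L)
  (hL : forall v, L * sqnorm2 v <= bil Sig v v) (hM : forall j, Sig j j <= M).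

Let Theta := invmx Sig.

Lemma posdef_unitmx : Sig \in unitmx.
Proof.
rewrite -row_free_unit -kermx_eq0; apply/rowV0P => u /sub_kermxP uS.
have := hL u^T; rewrite /bil trmxK uS mul0mx mxE => h.
have /eqP : sqnorm2 u^T = 0.
  by apply/eqP; rewrite eq_le sqnorm2_ge0 andbT -(ler_pM2l L0) mulr0.
by rewrite sqnorm2_eq0 trmx_eq0 => /eqP.
Qed.

Lemma trmx_Theta : Theta^T = Theta.
Proof. by rewrite /Theta trmx_inv symS. Qed.

Lemma posdef_bil_ge0 v : 0 <= bil Sig v v.
Proof. by apply: le_trans (hL v); rewrite mulr_ge0 ?sqnorm2_ge0 // ltW. Qed.

Lemma bil_Theta_row u j : bil Sig u (col j Theta) = u j 0.
Proof.
rewrite /bil colE -mulmxA [Sig *m _]mulmxA mulmxV ?posdef_unitmx // mul1mx.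
by rewrite -colE !mxE.
Qed.

Lemma Theta_diag_gt0 j : 0 < Theta j j.
Proof.
have := hL (col j Theta); rewrite bil_Theta_row mxE; apply: lt_le_trans.
rewrite mulr_gt0 // lt_neqAle sqnorm2_ge0 andbT eq_sym sqnorm2_eq0.
apply/eqP => c0; have := bil_Theta_row (delta_mx j 0) j.
by rewrite c0 /bil mulmx0 !mxE !eqxx => /eqP; rewrite eq_sym oner_eq0.
Qed.

Definition pop_dir j : 'cV[R]_p := (Theta j j)^-1 *: col j Theta.

Definition pop_gamma j : 'cV[R]_p.-1 := \col_k - pop_dir j (lift j k) 0.

Lemma pop_dirE j : pop_dir j = nodewise_dir j (pop_gamma j).
Proof.
apply/colP => k; rewrite [RHS]mxE; case: unliftP => [k'|] ->.
  by rewrite [pop_gamma j _ _]mxE opprK.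
by rewrite !mxE mulVf // gt_eqF // Theta_diag_gt0.
Qed.

Lemma bil_pop_dir u j : bil Sig u (pop_dir j) = u j 0 / Theta j j.
Proof. by rewrite bilZr bil_Theta_row mulrC. Qed.

Lemma pop_dir_diag j : pop_dir j j 0 = 1.
Proof. by rewrite !mxE mulVf // gt_eqF // Theta_diag_gt0. Qed.

Lemma bil_pop_dir_self j : bil Sig (pop_dir j) (pop_dir j) = (Theta j j)^-1.
Proof. by rewrite bil_pop_dir pop_dir_diag mul1r. Qed.

Lemma Theta_bil_pop_dir j k :
  Theta j k = bil Sig (pop_dir j) (pop_dir k) * Theta j j * Theta k k.
Proof.
have T0 i : Theta i i != 0 by rewrite gt_eqF // Theta_diag_gt0.
rewrite bil_pop_dir !mxE -{1}trmx_Theta mxE mulrAC divfK // mulrAC mulVf //.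
by rewrite mul1r.
Qed.

(** The quadratic form is evaluated at [pop_dir j], whose coordinate [j] is 1, so its squared norm
    is at least 1. *)
Lemma pop_tau2_ge j : L <= (Theta j j)^-1.
Proof.
rewrite -bil_pop_dir_self; apply: le_trans (hL _).
rewrite -[X in X <= _]mulr1 ler_pM2l // -(expr1n R 2) -(pop_dir_diag j).
exact: sqr_coord_le_sqnorm2.
Qed.

(* The population residual of regressing X_j on the others has smaller second
   moment than X_j itself. *)
Lemma pop_tau2_le j : (Theta j j)^-1 <= M.
Proof.
apply: le_trans (hM j); rewrite -bil_delta.
pose e : 'cV[R]_p := delta_mx j 0 - pop_dir j.
have := posdef_bil_ge0 e.
have h1 : bil Sig e (pop_dir j) = 0.
  by rewrite bil_pop_dir !mxE -/Theta mulVf ?eqxx ?subrr ?mul0r // gt_eqF // Theta_diag_gt0.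
rewrite {2}/e bilBr h1 subr0 /e bilBl (bilC (pop_dir j)) // bil_pop_dir.
by rewrite mxE !eqxx mul1r subr_ge0.
Qed.

Lemma bil_pop_dir_le j k : `|bil Sig (pop_dir j) (pop_dir k)| <= M.
Proof.
have := posdef_bil_ge0 (pop_dir j + pop_dir k).
have := posdef_bil_ge0 (pop_dir j - pop_dir k).
rewrite !(bilDl, bilDr, bilNl, bilNr) (bilC (pop_dir k) (pop_dir j)) //.
rewrite !bil_pop_dir_self; have := pop_tau2_le j; have := pop_tau2_le k.
move=> ? ? ? ?; rewrite ler_norml; apply/andP; split; lra.
Qed.

(** Cauchy-Schwarz on the support, whose size is [row_sparsity Theta j]. The l2-norm of [pop_dir j]
    is bounded through [L * sqnorm2 <= bil Sig], where the form equals [(Theta j j)^-1 <= M]. *)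
Lemma norm1_pop_gamma j :
  norm1 (pop_gamma j) ^+ 2 <= (row_sparsity Theta j)%:R * (M / L).
Proof.
have M0 : 0 <= M.
  by apply: le_trans (pop_tau2_le j); apply: le_trans (pop_tau2_ge j); exact: ltW.
pose S := [pred k | (k != j) && (Theta j k != 0)].
have -> : norm1 (pop_gamma j) = \sum_(k | S k) `|pop_dir j k 0|.
  rewrite [RHS]big_mkcond /= (bigD1_ord j) //= eqxx add0r.
  apply: eq_bigr => k _; rewrite eq_sym neq_lift /= [pop_gamma j _ _]mxE normrN.
  case: ifPn => //; rewrite negbK => /eqP T0.
  have T0' : Theta (lift j k) j = 0 by rewrite -trmx_Theta mxE.
  by rewrite /pop_dir !mxE -/Theta T0' mulr0 normr0.
apply: le_trans (norm1_sqr_le _ _) _.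
rewrite ler_wpM2l // ler_pdivlMr // mulrC.
by apply: le_trans (hL _) _; rewrite bil_pop_dir_self pop_tau2_le.
Qed.
End population.

(** * The nodewise lasso near its population version *)

Section nodewise_bounds.
Context {R : realType} {n p : nat}.
Variables (Sig : 'M[R]_p) (L M : R).
Hypotheses (symS : Sig^T = Sig) (L0 : 0 < L)
  (hL : forall v, L * sqnorm2 v <= bil Sig v v) (hM : forall j, Sig j j <= M).
Variables (x : 'M[R]_(n, p)) (lambda : 'I_p -> R) (gamma : 'I_p -> 'cV[R]_p.-1).
Hypotheses (l0 : forall j, 0 <= lambda j)
  (hgamma : is_nodewise_lasso lambda x gamma).

Let G := gram x.
Let Theta := invmx Sig.
Let c j := pop_dir Sig j.
Let h j := nodewise_dir j (gamma j).
Let t2 := tau2 lambda x gamma.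

(** Column [j] is the response of its own regression and carries no KKT bound; [nodewise_KKT_diag]
    treats it. *)
Lemma nodewise_KKT j k : `|bil G (h j) (delta_mx k 0)| <= lambda j \/ k = j.
Proof.
case: (unliftP j k) => [k'|] ->; [left|by right].
have := lasso_KKT k' (l0 j) (hgamma j).
rewrite -mulmx_nodewise_dir; congr (`|_| <= _).
rewrite bil_gram dotC.
rewrite dotC dot_mulmxr dot_delta !mxE; congr (_ / _).
by apply: eq_bigr => i _; rewrite !mxE.
Qed.

(** By [lasso_KKT_active] the penalty term in [tau2] is the inner product of the residual with the
    fit, and residual plus fit is column [j]. Hence dividing by [tau2] makes the diagonal of
    [Th *m G] exactly 1. *)
Lemma nodewise_KKT_diag j : bil G (h j) (delta_mx j 0) = t2 j.
Proof.
have := lasso_KKT_active (l0 j) (hgamma j); rewrite /t2 /tau2 => <-.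
rewrite bil_gram -mulrDl -dot_sqnorm2 -dotDr subrK /h mulmx_nodewise_dir.
by rewrite -colE.
Qed.

Variables (kappa e : R).
Hypotheses (e0 : 0 < e) (e1 : e <= 1)
  (hkap : forall j, 2 * kappa <= lambda j) (kape : kappa <= e ^+ 2)
  (hrho : forall j, 3 * (lambda j * norm1 (pop_gamma Sig j)) <= e ^+ 2)
  (hcc : forall j k, `|bil (G - Sig) (c j) (c k)| <= kappa)
  (hec : forall j k, `|bil (G - Sig) (delta_mx k 0) (c j)| <= kappa).

(** The in-sample prediction error. Its mean square is at most [e ^+ 2], so its products with
    vectors of bounded mean square are of order [e]: this is why the hypotheses involve [e ^+ 2] and
    the conclusions [e]. *)
Let v j := col' j x *m (gamma j - pop_gamma Sig j).

Let residE j : x *m h j = x *m c j - v j.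
Proof.
rewrite /c (pop_dirE L0 hL) /h !mulmx_nodewise_dir /v mulmxBr.
by rewrite opprB addrA subrK.
Qed.

(** The slow rate with [x *m c j] as noise. Its score against a column [k != j] is the form of
    [G - Sig] at [delta_mx k 0] and [c j], as [Sig *m c j] has no component there, so it is at most
    [kappa <= lambda j / 2]. *)
Let slow j :
  [/\ sqnorm2 (v j) / n%:R <= e ^+ 2,
      lambda j * norm1 (gamma j) <= e ^+ 2 &
      `|dot (x *m c j) (v j) / n%:R| <= e ^+ 2].
Proof.
have [|h1 h2 h3] := lasso_slow_rate (b0 := pop_gamma Sig j) (l0 j) (hgamma j).
  move=> k; rewrite -mulmx_nodewise_dir -(pop_dirE L0 hL) -/(c j).
  apply: le_trans (_ : kappa <= _); last by rewrite ler_pdivlMr // mulrC.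
  have := hec j (lift j k); rewrite bilBm (bil_pop_dir L0 hL).
  rewrite mxE (negbTE (neq_lift _ _)) mul0r subr0 -mulmx_gram_delta.
  congr (`|_| <= _); rewrite !mxE; congr (_ / _).
  by apply: eq_bigr => i _; rewrite !mxE.
have := hrho j; rewrite -mulmx_nodewise_dir -(pop_dirE L0 hL) in h3.
have r0 : 0 <= lambda j * norm1 (pop_gamma Sig j) by rewrite mulr_ge0 ?norm1_ge0.
move=> hr; split; [exact: le_trans h1 hr|exact: le_trans h2 hr|].
by apply: le_trans h3 _; lra.
Qed.

Let ccE j : `|sqnorm2 (x *m c j) / n%:R - (Theta j j)^-1| <= e ^+ 2.
Proof.
have := hcc j j; rewrite bilBm (bil_pop_dir_self L0 hL) bil_gram dot_sqnorm2.
by move=> /le_trans; apply.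
Qed.

(** Five errors of size [e ^+ 2]: one from [ccE], two from the doubled cross term, one from the
    prediction error and one from the penalty. *)
Lemma tau2_dist j : `|t2 j - (Theta j j)^-1| <= 5 * e.
Proof.
have [h1 h2 h3] := slow j.
have ee : e ^+ 2 <= e by rewrite expr2 ler_piMr // ltW.
have := ccE j; move: h3; rewrite /t2 /tau2 -mulmx_nodewise_dir -/(h j) residE.
rewrite sqnorm2B [(_ - _ + sqnorm2 (v j)) / _]mulrDl mulrBl -mulrA.
rewrite !ler_norml => /andP[? ?] /andP[? ?].
have ? : 0 <= sqnorm2 (v j) / n%:R by rewrite divr_ge0 ?sqnorm2_ge0.
have ? : 0 <= lambda j * norm1 (gamma j) by rewrite mulr_ge0 ?norm1_ge0.
apply/andP; split; lra.
Qed.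

(** Expand both residuals as [x *m c - v]. The weight [e] in [young_dot] bounds each of the two
    cross terms by [e * (M + 2) / 2]; the product of the two errors and [kappa] add at most [e]
    each. *)
Lemma resid_gram_dist j k :
  `|bil G (h j) (h k) - bil Sig (c j) (c k)| <= (M + 4) * e.
Proof.
have ee : e ^+ 2 <= e by rewrite expr2 ler_piMr // ltW.
have M0 : 0 <= M.
  apply: le_trans (pop_tau2_le symS L0 hL hM j).
  by apply: le_trans (pop_tau2_ge L0 hL j); exact: ltW.
have cross i l : `|dot (x *m c i) (v l) / n%:R| <= e * (M + 2) / 2.
  rewrite normrM [X in _ * X]ger0_norm ?invr_ge0 //.
  apply: le_trans (ler_wpM2r (_ : 0 <= n%:R^-1) (young_dot _ _ e0)) _.
    by rewrite invr_ge0.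
  have -> : (e * sqnorm2 (x *m c i) + e^-1 * sqnorm2 (v l)) / 2 / n%:R =
    (e * (sqnorm2 (x *m c i) / n%:R) + e^-1 * (sqnorm2 (v l) / n%:R)) / 2 by ring.
  rewrite ler_pM2r ?invr_gt0 // [e * (M + 2)](_ : _ = e * (M + 1) + e); last ring.
  rewrite lerD //.
    rewrite ler_pM2l //; have := ccE i; rewrite ler_norml => /andP[_].
    have := pop_tau2_le symS L0 hL hM i; rewrite -/Theta => tM sM; move: (lerD sM tM).
    rewrite subrK => /le_trans; apply; rewrite addrC lerD2l; exact: le_trans ee e1.
  have [h1 _ _] := slow l.
  by rewrite mulrC ler_pdivrMr // -expr2.
have vv : `|dot (v j) (v k) / n%:R| <= e ^+ 2.
  rewrite normrM [X in _ * X]ger0_norm ?invr_ge0 //.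
  apply: le_trans (ler_wpM2r (_ : 0 <= n%:R^-1) (young_dot _ _ ltr01)) _.
    by rewrite invr_ge0.
  have [h1 _ _] := slow j; have [h2 _ _] := slow k.
  rewrite invr1 !mul1r mulrAC mulrDl; lra.
have := cross j k; have := cross k j; have := hcc j k.
rewrite bilBm !bil_gram !residE !(dotDl, dotDr, dotNl, dotNr) (dotC (v j) (x *m _)).
rewrite [(_ + (_ + _)) / _](_ : _ = dot (x *m c j) (x *m c k) / n%:R
   - dot (x *m c j) (v k) / n%:R - dot (x *m c k) (v j) / n%:R
   + dot (v j) (v k) / n%:R); last ring.
move: vv; rewrite !ler_norml => /andP[? ?] /andP[? ?] /andP[? ?] /andP[? ?].
by apply/andP; split; have := kape; have := e0; lra.
Qed.


Hypothesis eL : 5 * e <= L / 2.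

Lemma tau2_ge j : L / 2 <= t2 j.
Proof.
have := tau2_dist j; have := pop_tau2_ge L0 hL j.
rewrite -/Theta ler_norml => ? /andP[? _]; have := eL; lra.
Qed.

Let Th := Theta_lasso lambda x gamma.

Let t2_gt0 j : 0 < t2 j.
Proof. by apply: lt_le_trans (tau2_ge j); rewrite divr_gt0. Qed.

Let ThE j k : Th j k = (t2 j)^-1 * h j k 0.
Proof.
rewrite /Th Theta_lassoE; case: ifPn => // /forallP; case=> i.
by rewrite gt_eqF.
Qed.

Let ThE_row j : (row j Th)^T = (t2 j)^-1 *: h j.
Proof. by apply/colP => k; rewrite mxE [LHS]mxE [RHS]mxE ThE. Qed.

Lemma Theta_lasso_gram_dist l j k : (forall i, lambda i <= l) ->
  `|(Th *m G - 1%:M) j k| <= 2 * l / L.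
Proof.
move=> hl; have t2n i : t2 i != 0 by rewrite gt_eqF.
have -> : (Th *m G - 1%:M) j k = (t2 j)^-1 * (bil G (h j) (delta_mx k 0))
   - (j == k)%:R.
  rewrite [LHS]mxE [(- 1%:M) j k]mxE [1%:M j k]mxE; congr (_ - _).
  by rewrite -bilZl -ThE_row /bil trmxK -colE -row_mul !mxE.
have [kj|->] := nodewise_KKT j k; last first.
  rewrite nodewise_KKT_diag mulVf // eqxx subrr normr0.
  by rewrite !mulr_ge0 ?invr_ge0 // ?(ltW L0) //; apply: le_trans (hl j).
have [->|jk] := eqVneq j k.
  rewrite nodewise_KKT_diag mulVf // subrr normr0.
  by rewrite !mulr_ge0 ?invr_ge0 // ?(ltW L0) //; apply: le_trans (hl j).
rewrite subr0 normrM gtr0_norm ?invr_gt0 // mulrC ler_pdivrMr //.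
apply: le_trans kj _; apply: le_trans (hl j) _.
have l_ge0 : 0 <= l by apply: le_trans (hl j).
have -> : 2 * l / L * t2 j = l * (2 * t2 j / L) by ring.
by rewrite ler_peMr // ler_pdivlMr // mul1r mulrC -ler_pdivrMr // tau2_ge.
Qed.

Lemma Omega_hat_dist j k :
  `|(Omega_hat Th x - Theta) j k| <=
  e * ((M + 4) + 15 * M ^+ 2 / L ^+ 2) * 4 / L ^+ 2.
Proof.
have -> : (Omega_hat Th x - Theta) j k =
    bil G (h j) (h k) / (t2 j * t2 k) - Theta j k.
  rewrite [LHS]mxE [(- Theta) j k]mxE; congr (_ - _).
  transitivity (bil G (row j Th)^T (row k Th)^T).
    by rewrite /bil trmxK -row_mul /Omega_hat -/G !mxE; apply: eq_bigr => i _; rewrite !mxE.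
  by rewrite !ThE_row bilZl bilZr mulrA -invfM mulrC.
rewrite (Theta_bil_pop_dir symS L0 hL) -/Theta -/(c j) -/(c k).
have N := resid_gram_dist j k; have N0 := bil_pop_dir_le symS L0 hL hM j k.
move: N N0; rewrite -/(c j) -/(c k).
set N := bil G _ _; set N0 := bil Sig _ _ => NN0 N0M.
have T0 i : Theta i i != 0 by rewrite gt_eqF // (Theta_diag_gt0 L0 hL).
set a := t2 j; set b := t2 k.
have [an bn] : a != 0 /\ b != 0 by split; rewrite gt_eqF ?t2_gt0.
pose a0 := (Theta j j)^-1; pose b0 := (Theta k k)^-1.
(* Everything is put over [a * b], at least [L ^+ 2 / 4], and [a * b - a0 * b0] is telescoped. Since
   [b <= 2 * M] and [a0 <= M], the telescoped terms contribute [10 * M * e] and [5 * M * e], whence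
   the 15 below. *)
have -> : N / (a * b) - N0 * Theta j j * Theta k k =
   (N - N0 - N0 * ((a - a0) * b + a0 * (b - b0)) / (a0 * b0)) / (a * b).
  by rewrite /a0 /b0; field; rewrite an bn !T0.
have [aL bL] : L / 2 <= a /\ L / 2 <= b by rewrite !tau2_ge.
have [a0L b0L] : L <= a0 /\ L <= b0 by rewrite !(pop_tau2_ge L0 hL).
have [a0M b0M] : a0 <= M /\ b0 <= M by rewrite !(pop_tau2_le symS L0 hL hM).
have da : `|a - a0| <= 5 * e := tau2_dist j.
have db : `|b - b0| <= 5 * e := tau2_dist k.
have L2 : 0 < L / 2 by rewrite divr_gt0.
have M0 : 0 < M by apply: lt_le_trans a0M; apply: lt_le_trans a0L.
have bM : b <= 2 * M.
  by move: db; rewrite ler_norml => /andP[_]; have := eL; lra.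
have ab : L ^+ 2 / 4 <= a * b.
  rewrite (_ : L ^+ 2 / 4 = L / 2 * (L / 2)); last by field.
  by rewrite ler_pM // ltW.
have a0b0 : L ^+ 2 <= a0 * b0 by rewrite expr2 ler_pM // ltW.
have ab0 : 0 < a * b by rewrite mulr_gt0 // (lt_le_trans L2).
have a0b00 : 0 < a0 * b0 by rewrite mulr_gt0 // (lt_le_trans L0).
have LL : 0 < L ^+ 2 by rewrite exprn_gt0.
rewrite normrM [`|(a * b)^-1|]gtr0_norm ?invr_gt0 // ler_pdivrMr //.
have D : `|(a - a0) * b + a0 * (b - b0)| <= 15 * M * e.
  apply: le_trans (ler_normD _ _) _; rewrite !normrM.
  rewrite (gtr0_norm (lt_le_trans L2 bL)) (gtr0_norm (lt_le_trans L0 a0L)).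
  have h1 : `|a - a0| * b <= 5 * e * (2 * M).
    by apply: ler_pM => //; apply: ltW; exact: lt_le_trans bL.
  have h2 : a0 * `|b - b0| <= M * (5 * e).
    by apply: ler_pM => //; apply: ltW; exact: lt_le_trans a0L.
  lra.
set E := e * (M + 4 + 15 * M ^+ 2 / L ^+ 2).
have hE : `|N - N0 - N0 * ((a - a0) * b + a0 * (b - b0)) / (a0 * b0)| <= E.
  apply: le_trans (ler_normB _ _) _.
  have -> : E = (M + 4) * e + e * (15 * M ^+ 2 / L ^+ 2) by rewrite /E; ring.
  rewrite lerD //.
  rewrite !normrM [`|(a0 * b0)^-1|]gtr0_norm ?invr_gt0 // ler_pdivrMr //.
  apply: (@le_trans _ _ (M * (15 * M * e))).
    by apply: ler_pM.
  have -> : M * (15 * M * e) = e * (15 * M ^+ 2 / L ^+ 2) * L ^+ 2.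
    by field; rewrite gt_eqF.
  rewrite ler_wpM2l //.
  by rewrite !mulr_ge0 ?invr_ge0 // ?ltW // exprn_gt0.
apply: le_trans hE _.
have E0 : 0 <= E.
  by rewrite /E mulr_ge0 ?ltW // addr_gt0 ?divr_gt0 ?mulr_gt0 ?exprn_gt0 ?addr_gt0.
have -> : E * 4 / L ^+ 2 * (a * b) = E * (a * b / (L ^+ 2 / 4)).
  by field; rewrite gt_eqF.
by rewrite ler_peMr // ler_pdivlMr ?divr_gt0 // mul1r.
Qed.

End nodewise_bounds.

(** * Measurability of matrix-valued maps and transfer of integrals *)

Section matrix_measurability.
Context {R : realType} {d : measure_display} {T : measurableType d}.

Lemma measurable_coord m n (i : 'I_m) (j : 'I_n) :
  measurable_fun setT (fun A : 'M[R]_(m, n) => A i j).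
Proof.
move=> _ B mB; rewrite setTI; apply: sub_sigma_algebra.
by exists (i, j) => //; exists B; rewrite ?setTI.
Qed.

Lemma measurable_mx m n (f : T -> 'M[R]_(m, n)) :
  (forall i j, measurable_fun setT (fun w => f w i j)) -> measurable_fun setT f.
Proof.
move=> mf; apply: (measurability (mx_coord_sets (R:=R) (m:=m) (n:=n))) => //.
move=> _ [_ [[i j] _ [B mB <-]] <-]; rewrite !setTI.
by have := mf i j measurableT B mB; rewrite setTI.
Qed.

Lemma measurable_mxcoord m n (f : T -> 'M[R]_(m, n)) i j :
  measurable_fun setT f -> measurable_fun setT (fun w => f w i j).
Proof. by move=> mf; exact: (measurableT_comp (measurable_coord i j) mf). Qed.

Lemma measurable_mulmx m n q (f : T -> 'M[R]_(m, n)) (g : T -> 'M[R]_(n, q)) :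
  measurable_fun setT f -> measurable_fun setT g ->
  measurable_fun setT (fun w => f w *m g w).
Proof.
move=> mf mg; apply: measurable_mx => i j.
under eq_fun do rewrite mxE.
by apply: measurable_sum => k; apply: measurable_funM; exact: measurable_mxcoord.
Qed.

Lemma measurable_addmx m n (f g : T -> 'M[R]_(m, n)) :
  measurable_fun setT f -> measurable_fun setT g ->
  measurable_fun setT (fun w => f w + g w).
Proof.
move=> mf mg; apply: measurable_mx => i j.
under eq_fun do rewrite mxE.
by apply: measurable_funD; exact: measurable_mxcoord.
Qed.

Lemma measurable_scalemx m n (a : R) (f : T -> 'M[R]_(m, n)) :
  measurable_fun setT f -> measurable_fun setT (fun w => a *: f w).
Proof.
move=> mf; apply: measurable_mx => i j.
under eq_fun do rewrite mxE.
by apply: measurable_funM; [exact: measurable_cst|exact: measurable_mxcoord].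
Qed.

Lemma measurable_trmx m n (f : T -> 'M[R]_(m, n)) :
  measurable_fun setT f -> measurable_fun setT (fun w => (f w)^T).
Proof.
move=> mf; apply: measurable_mx => i j.
by under eq_fun do rewrite mxE; exact: measurable_mxcoord.
Qed.

Lemma measurable_lt_mx_norm m n (f : T -> 'M[R]_(m, n)) (a : R) : 0 < a ->
  measurable_fun setT f -> measurable [set w | a < `|f w|].
Proof.
move=> a0 mf.
have -> : [set w | a < `|f w|] =
    \bigcup_(ij in [set: 'I_m * 'I_n]) [set w | a < `|f w ij.1 ij.2|].
  apply/seteqP; split => w /=.
    rewrite [ltRHS]mx_normrE => /bigmax_gtP[|[ij _ h]]; last by exists ij.
    by rewrite ltNge (ltW a0).
  move=> [ij _ /= h]; rewrite [ltRHS]mx_normrE; apply/bigmax_gtP; right.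
  by exists ij.
apply: fin_bigcup_measurable; first exact: finite_finset.
move=> [i j] _ /=; rewrite -[X in measurable X]setTI.
apply: (measurable_fun_ltr (f := cst a)
  (g := fun w => `|f w i j|) _ _ measurableT (Y := [set true])) => //.
by apply: measurableT_comp => //; exact: measurable_mxcoord.
Qed.

(** With [0^-1 = 0] the inverse is discontinuous at 0, so it is glued from a constant at 0 and a
    continuous function on the open complement. *)
Lemma measurable_funV (f : T -> R) :
  measurable_fun setT f -> measurable_fun setT (fun w => (f w)^-1).
Proof.
move=> mf; apply: (@measurableT_comp _ _ _ _ _ _ (@GRing.inv R)) => //.
rewrite (_ : @GRing.inv R = fun x => if x == 0 then 0 else x^-1); last first.
  by apply/funext => x; case: eqP => // ->; rewrite invr0.
apply: measurable_fun_if => //.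
  by apply: measurable_fun_eqr => //; exact: measurable_cst.
rewrite setTI (_ : _ @^-1` _ = [set x : R | x != 0]); last first.
  by apply/seteqP; split => x /=; case: eqP.
apply: open_continuous_measurable_fun; first exact: open_neq.
by move=> x; rewrite inE => x0; exact: inv_continuous.
Qed.

End matrix_measurability.

Section change_of_measure.
Local Open Scope ereal_scope.
Context {R : realType} {d1 d2 d : measure_display} {X1 : measurableType d1}
  {X2 : measurableType d2} {Y : measurableType d}.
Variables (m1 : {measure set X1 -> \bar R}) (m2 : {measure set X2 -> \bar R})
  (phi1 : X1 -> Y) (phi2 : X2 -> Y) (g1 : X1 -> R) (g2 : X2 -> R).
Hypotheses (mphi1 : measurable_fun setT phi1) (mphi2 : measurable_fun setT phi2)
  (mg1 : measurable_fun setT g1) (mg2 : measurable_fun setT g2)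
  (g10 : forall x, (0 <= g1 x)%R) (g20 : forall x, (0 <= g2 x)%R).
Hypothesis eq_indic : forall B, measurable B ->
  \int[m1]_x ((\1_B (phi1 x))%:E * (g1 x)%:E) = \int[m2]_x ((\1_B (phi2 x))%:E * (g2 x)%:E).

Import HBNNSimple.

Let eq_nnsfun (f : {nnsfun Y >-> R}) :
  \int[m1]_x ((f (phi1 x))%:E * (g1 x)%:E) = \int[m2]_x ((f (phi2 x))%:E * (g2 x)%:E).
Proof.
have H d' (X : measurableType d') (m : {measure set X -> \bar R}) (phi : X -> Y)
    (g : X -> R) : measurable_fun setT phi -> measurable_fun setT g ->
    (forall x, (0 <= g x)%R) -> \int[m]_x ((f (phi x))%:E * (g x)%:E) =
    \sum_(r \in range f) (r%:E * \int[m]_x ((\1_(f @^-1` [set r]) (phi x))%:E * (g x)%:E)).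
  move=> mphi mg g0.
  have mi r : measurable_fun setT (fun x => ((\1_(f @^-1` [set r]) (phi x))%:E * (g x)%:E)).
    apply: emeasurable_funM => //; apply/measurable_EFinP => //.
    by apply: measurableT_comp => //; exact: measurable_indic.
  transitivity (\int[m]_x (\sum_(r \in range f)
      (r%:E * ((\1_(f @^-1` [set r]) (phi x))%:E * (g x)%:E)))).
    apply: eq_integral => x _.
    rewrite {1}fimfunE -fsumEFin // ge0_mule_fsuml //; last first.
      by move=> r; rewrite nnfun_muleindic_ge0.
    by apply: eq_fsbigr => r _; rewrite EFinM muleA.
  rewrite ge0_integral_fsum //; last 2 first.
  - by move=> r; exact: measurable_funeM.
  - move=> r x _; rewrite muleA mule_ge0 ?lee_fin //.
    exact: nnfun_muleindic_ge0.
  apply: eq_fsbigr => r /[1!inE] -[y _ <-].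
  rewrite ge0_integralZl // => [x _|]; first by rewrite mule_ge0 // lee_fin.
  by rewrite lee_fin.
rewrite !H //; apply: eq_fsbigr => r _; congr (_ * _).
by apply: eq_indic; exact: measurable_sfunP.
Qed.

(** From indicators to simple functions to monotone limits. The weights [g1] and [g2] let the same
    argument treat a density and the remaining factors of a product of independent variables. *)
Lemma ge0_integral_transfer (f : Y -> \bar R) : measurable_fun setT f ->
  (forall y, 0 <= f y) ->
  \int[m1]_x (f (phi1 x) * (g1 x)%:E) = \int[m2]_x (f (phi2 x) * (g2 x)%:E).
Proof.
move=> mf f0; pose f_ := nnsfun_approx measurableT mf.
have H d' (X : measurableType d') (m : {measure set X -> \bar R}) (phi : X -> Y)
    (g : X -> R) : measurable_fun setT phi -> measurable_fun setT g ->
    (forall x, (0 <= g x)%R) -> \int[m]_x (f (phi x) * (g x)%:E) =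
    limn (fun n => \int[m]_x ((f_ n (phi x))%:E * (g x)%:E)).
  move=> mphi mg g0; rewrite -monotone_convergence //.
  - apply: eq_integral => x _; apply/esym/cvg_lim => //.
    by apply: cvgeZr => //; exact: cvg_nnsfun_approx.
  - move=> n; apply: emeasurable_funM => //; apply/measurable_EFinP => //.
    by apply: measurableT_comp.
  - by move=> n x _; rewrite mule_ge0 // lee_fin.
  - move=> x _ a b ab; apply: lee_wpmul2r; rewrite lee_fin //; exact/lefP/nd_nnsfun_approx.
by rewrite !H //; under eq_fun do rewrite eq_nnsfun.
Qed.

End change_of_measure.

(** * Independence *)

Section independence_theory.
Context {R : realType} {d : measure_display} {T : measurableType d}
  (P : probability T R).

Lemma integral_prod_independent {d1 : measure_display} {T1 : measurableType d1}
    (I : finType) (Z : I -> T -> T1) (F : I -> T1 -> R) (E : I -> R) :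
  (forall i, measurable_fun setT (Z i)) -> mutually_independent_rv P Z ->
  (forall i, measurable_fun setT (F i)) -> (forall i z, 0 <= F i z) ->
  (forall i, (\int[P]_w (F i (Z i w))%:E = (E i)%:E)%E) ->
  (\int[P]_w (\prod_i F i (Z i w))%:E = (\prod_i E i)%:E)%E.
Proof.
move=> mZ indep.
have mF (F' : T1 -> R) i : measurable_fun setT F' ->
    measurable_fun setT (fun w => F' (Z i w)).
  by move=> mF'; exact: measurableT_comp mF' (mZ i).
(* Induction on the list of indices whose factor may be arbitrary. Outside the list all factors are
   indicators, so the empty list is the definition of independence. *)
suff H (s : seq I) : forall (F : I -> T1 -> R) (E : I -> R),
    (forall i, measurable_fun setT (F i)) -> (forall i z, 0 <= F i z) ->
    (forall i, (\int[P]_w (F i (Z i w))%:E = (E i)%:E)%E) ->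
    (forall i, i \notin s -> exists2 B, measurable B & F i = \1_B) ->
    (\int[P]_w (\prod_i F i (Z i w))%:E = (\prod_i E i)%:E)%E.
  move=> mF0 F0 EF; apply: (H (enum I)) => // i.
  by rewrite mem_enum.
elim: s => [|k s IH] {}F {}E mF0 F0 EF Find.
  have /choice[B HB] : forall i, exists B, measurable B /\ F i = \1_B.
    by move=> i; have [//|B mB FB] := Find i; exists B.
  have mB i : measurable (B i) by have [] := HB i.
  have FB i : F i = \1_(B i) by have [] := HB i.
  have EB i : P (Z i @^-1` B i) = (E i)%:E.
    rewrite -EF; under eq_integral do rewrite FB.
    rewrite -[in LHS](setIT (_ @^-1` _)) -integral_indic //.
    by rewrite -[X in measurable X]setTI; exact: mZ.
  transitivity (P (\bigcap_(i in [set: I]) (Z i @^-1` B i))).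
    rewrite -[in RHS](setIT (\bigcap_(i in _) _)) -integral_indic //; last first.
      apply: fin_bigcap_measurable => // i _.
      by rewrite -[X in measurable X]setTI; exact: mZ.
    apply: eq_integral => w _; congr (_%:E).
    rewrite indicE; case: (boolP (w \in _)) => [|wB].
      rewrite inE => wB; rewrite big1 // => i _; rewrite FB indicE mem_set //.
      exact: wB.
    have [i wBi] : exists i, ~ B i (Z i w).
      apply/existsNP => wBi; move/negP: wB; apply; rewrite inE => i _; exact: wBi.
    by rewrite (bigD1 i) //= FB indicE memNset // mul0r.
  rewrite indep // (eq_bigr (fun i => (E i)%:E)) //.
  by rewrite prodEFin.
have [ks|ks] := boolP (k \in s).
  apply: IH => // i iNs; apply: Find; rewrite in_cons negb_or iNs andbT.
  by apply: contraNneq iNs => ->.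
pose h w := \prod_(i | i != k) F i (Z i w).
pose c := \prod_(i | i != k) E i.
have E0 i : 0 <= E i.
  by rewrite -lee_fin -EF; apply: integral_ge0 => w _; rewrite lee_fin.
have -> : (\int[P]_w (\prod_i F i (Z i w))%:E =
    \int[P]_w ((F k (Z k w))%:E * (h w)%:E))%E.
  by apply: eq_integral => w _; rewrite (bigD1 k) // EFinM.
rewrite (bigD1 k) //= -/c EFinM -EF.
rewrite -ge0_integralZr //; last 3 first.
- by apply/measurable_EFinP; exact: mF.
- by move=> w _; rewrite lee_fin.
- by rewrite lee_fin prodr_ge0.
(* Factor [k] is released: weighting [\1_B (Z k)] by the product [h] of the other factors or by the
   constant [c] gives the same integral by induction, hence so does weighting [F k (Z k)]. *)
apply: (@ge0_integral_transfer _ _ _ _ _ _ _ P P (Z k) (Z k) h (cst c)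
  _ _ _ _ _ _ _ (fun z => (F k z)%:E)) => //.
- rewrite /h; under eq_fun do rewrite -big_filter.
  by apply: measurable_prod => i _; exact: mF.
- by move=> w; exact: prodr_ge0.
- by move=> w; exact: prodr_ge0.
- move=> B mB.
  pose F' i := if i == k then \1_B else F i.
  pose E' i := if i == k then fine (P (Z k @^-1` B)) else E i.
  have mZB : measurable (Z k @^-1` B).
    by rewrite -[X in measurable X]setTI; exact: mZ.
  have IB : (\int[P]_w (\1_B (Z k w))%:E = (E' k)%:E)%E.
    rewrite /E' eqxx fineK ?fin_num_measure //.
    by rewrite -[in RHS](setIT (_ @^-1` _)) -integral_indic.
  under [RHS]eq_integral do rewrite [cst c _]/cst.
  rewrite ge0_integralZr //; last 2 first.
  + apply/measurable_EFinP; apply: mF; exact: measurable_indic.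
  + by rewrite lee_fin prodr_ge0.
  have -> : c = \prod_(i | i != k) E' i.
    by apply: eq_bigr => i /negbTE ik; rewrite /E' ik.
  rewrite IB -EFinM.
  have := IH F' E'; rewrite (bigD1 k) //= => <-.
  + apply: eq_integral => w _; rewrite (bigD1 k) //= {1}/F' eqxx EFinM.
    by congr (_ * _%:E)%E; apply: eq_bigr => i /negbTE ik; rewrite /F' ik.
  + move=> i; rewrite /F'; case: ifP => // _; exact: measurable_indic.
  + by move=> i z; rewrite /F'; case: ifP.
  + by move=> i; rewrite /F' /E'; case: ifPn => // /eqP ->; rewrite IB /E' eqxx.
  + move=> i iNs; rewrite /F'; case: ifPn => ik; first by exists B.
    by apply: Find; rewrite in_cons negb_or ik.
- by apply/measurable_EFinP.
- by move=> y; rewrite lee_fin.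
Qed.

(** Independence identifies the joint law on rectangles, hence with the product measure. This is the
    device by which the design is frozen while the noise is integrated. *)
Lemma independent_joint {d1 d2 : measure_display} {T1 : measurableType d1}
    {T2 : measurableType d2} (X : {RV P >-> T1}) (Y : {RV P >-> T2}) A :
  independent_rv P X Y -> measurable A ->
  P [set w | A (X w, Y w)] =
    (\int[P]_w distribution P Y (xsection A (X w)))%E.
Proof.
move=> indep mA.
have mXY : measurable_fun setT (fun w => (X w, Y w)).
  by apply: measurable_fun_pair; exact: measurable_funPT.
pose XY : {RV P >-> (T1 * T2)%type} :=
  HB.pack (fun w => (X w, Y w)) (isMeasurableFun.Build _ _ _ _ _ mXY).
transitivity (distribution P XY A) => //.
rewrite -(product_measure_unique (m1 := distribution P X) (m2 := distribution P Y)) //.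
  rewrite /product_measure1 /=.
  by rewrite ge0_integral_pushforward //; exact: measurable_fun_xsection.
Qed.
End independence_theory.

(** * Gaussian moments *)

Section exponential_bounds.
Context {R : realType}.
Implicit Types x : R.

(** Both signs follow from [expR x * (1 - x) <= 1], which for negative [x] even gives
    [1 + x + x ^+ 2]. *)
Lemma expR_le_quadratic x : expR x <= 1 + x + x ^+ 2 * expR `|x|.
Proof.
have [x0|x0] := leP 0 x.
  rewrite ger0_norm //.
  have h1 : expR x * (1 - x) <= 1.
    rewrite -[leRHS](expR0 R) -(addrN x) expRD ler_pM2l ?expR_gt0 //.
    exact: expR_ge1Dx.
  have : 0 <= x * (x * expR x - (expR x - 1)).
    rewrite mulr_ge0 //; lra.
  lra.
rewrite ltr0_norm //.
have e1 : 0 < 1 - x by lra.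
have h : expR x * (1 - x) <= 1.
  rewrite -[leRHS](expR0 R) -(addrN x) expRD ler_pM2l ?expR_gt0 //.
  exact: expR_ge1Dx.
have h2 : expR x <= 1 + x + x ^+ 2.
  rewrite -(ler_pM2r e1); apply: le_trans h _.
  have : 0 <= x ^+ 2 * (- x) by rewrite mulr_ge0 ?sqr_ge0 //; lra.
  lra.
apply: le_trans h2 _; rewrite lerD2l ler_peMr ?sqr_ge0 //.
by apply: le_trans (expR_ge1Dx _); lra.
Qed.

Lemma sqr_le_expR x : 0 <= x -> x ^+ 2 <= 16 * expR (x / 2).
Proof.
move=> x0; have -> : x / 2 = x / 4 + x / 4 by lra.
have h : x / 4 <= expR (x / 4) by apply: le_trans (expR_ge1Dx _); lra.
have : (x / 4) ^+ 2 <= expR (x / 4) ^+ 2 by rewrite ler_sqr ?nnegrE ?expR_ge0 //; lra.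
rewrite expRD -expr2; lra.
Qed.

Lemma expR_quarter_le : expR (4^-1 : R) <= 4 / 3.
Proof.
have h : expR (4^-1 : R) * (1 - 4^-1) <= 1.
  rewrite -[leRHS](expR0 R) -(addrN 4^-1) expRD ler_pM2l ?expR_gt0 //.
  exact: expR_ge1Dx.
lra.
Qed.

Lemma sqrt2_le : Num.sqrt (2 : R) <= 3 / 2.
Proof.
have -> : 3 / 2 = Num.sqrt ((3 / 2) ^+ 2) :> R.
  by rewrite sqrtr_sqr ger0_norm.
by rewrite ler_wsqrtr //; lra.
Qed.

End exponential_bounds.

Section gaussian_moments.
Context {R : realType}.
Local Notation leb := (@lebesgue_measure R).
Variables (mu : {measure set R -> \bar R}) (m v : R).
Hypotheses (v0 : 0 <= v)
  (hmu : forall B, measurable B -> mu B = normal_law m v B).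

Let s := Num.sqrt v.

Lemma normal_law_integral0 (f : R -> \bar R) : v = 0 ->
  measurable_fun setT f -> (\int[mu]_z f z = f m)%E.
Proof.
move=> v_0 mf; rewrite (eq_measure_integral \d_m) => [|B mB _]; last first.
  by rewrite hmu // /normal_law v_0 eqxx.
by rewrite integral_dirac // diracT mul1e.
Qed.

Lemma normal_law_integral (f : R -> \bar R) : 0 < v ->
  measurable_fun setT f -> (forall z, 0 <= f z)%E ->
  (\int[mu]_z f z = \int[leb]_z (f z * (normal_pdf m s z)%:E))%E.
Proof.
move=> v_gt0 mf f0.
transitivity (\int[mu]_z (f z * (cst 1%R z)%:E))%E.
  by apply: eq_integral => z _; rewrite mule1.
apply: (@ge0_integral_transfer _ _ _ _ _ _ _ mu leb id id (cst 1%R) (normal_pdf m s)) => //.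
- exact: measurable_normal_pdf.
- by move=> z; exact: normal_pdf_ge0.
move=> B mB; transitivity (mu B).
  under eq_integral do rewrite mule1.
  by rewrite integral_indic ?setIT.
rewrite hmu // /normal_law gt_eqF // /normal_prob [LHS]integral_mkcond.
apply: eq_integral => z _; rewrite patchE indicE.
by case: ifP => _; rewrite ?mul1e ?mul0e.
Qed.

(** The exponents add up to [- (z - m) ^+ 2 / (4 * v)], a normal density with doubled variance up to
    its peak. The exponential moment is therefore [Num.sqrt 2], read off from the total mass of that
    density. *)
Lemma normal_pdf_widen z : 0 < v ->
  expR ((z - m) ^+ 2 / (4 * v)) * normal_pdf m s z =
  Num.sqrt 2 * normal_pdf m (Num.sqrt 2 * s) z.
Proof.
move=> v_gt0.
have s0 : s != 0 by rewrite gt_eqF // sqrtr_gt0.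
have r2 : Num.sqrt 2 != 0 :> R by rewrite gt_eqF // sqrtr_gt0.
have s2 : s ^+ 2 = v by rewrite sqr_sqrtr.
rewrite !normal_pdfE ?mulf_neq0 // /normal_fun /normal_peak exprMn !s2 sqr_sqrtr //.
rewrite mulrCA -expRD [RHS]mulrA; congr (_ * expR _); last first.
  by field; rewrite gt_eqF.
have -> : 2 * v * pi *+ 2 = 2 * (v * pi *+ 2) by ring.
by rewrite sqrtrM // invfM mulrA divff // mul1r.
Qed.

Lemma measurable_centered_exp :
  measurable_fun setT (fun z : R => expR ((z - m) ^+ 2 / (4 * v))).
Proof.
apply: measurableT_comp => //; apply: measurable_funM => //.
by apply: measurable_funX; exact: measurable_funB.
Qed.

Lemma normal_law_centered_exp : 0 < v ->
  (\int[mu]_z (expR ((z - m) ^+ 2 / (4 * v)))%:E <= (3 / 2)%:E)%E.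
Proof.
move=> v_gt0.
have ms := measurable_centered_exp.
rewrite normal_law_integral //; last exact/measurable_EFinP.
under eq_integral do rewrite -EFinM normal_pdf_widen // EFinM.
rewrite ge0_integralZl ?lee_fin ?sqrtr_ge0 //; last 2 first.
- by apply/measurable_EFinP; exact: measurable_normal_pdf.
- by move=> z _; rewrite lee_fin normal_pdf_ge0.
by rewrite integral_normal_pdf mule1 lee_fin sqrt2_le.
Qed.

Lemma measurable_expR_sqr (c : R) :
  measurable_fun setT (fun z : R => expR (z ^+ 2 * c)).
Proof.
by apply: measurableT_comp => //; apply: measurable_funM => //; exact: measurable_funX.
Qed.

(** From [z ^+ 2 <= 2 * m ^+ 2 + 2 * (z - m) ^+ 2] the exponent is at most
    [1 / 4 + (z - m) ^+ 2 / (4 * v)], and the bounds [4 / 3] and [3 / 2] multiply to 2. *)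
Lemma normal_law_sqr_exp Q : 0 < Q -> m ^+ 2 + v <= Q ->
  (\int[mu]_z (expR (z ^+ 2 / (8 * Q)))%:E <= 2%:E)%E.
Proof.
move=> Q0 hQ.
have mE := measurable_expR_sqr (8 * Q)^-1.
move: v0; rewrite le_eqVlt => /predU1P[/esym v_0|v_gt0].
  rewrite normal_law_integral0 //; last exact/measurable_EFinP.
  rewrite lee_fin; apply: (@le_trans _ _ (4 / 3)); last lra.
  apply: le_trans expR_quarter_le; rewrite ler_expR ler_pdivrMr ?mulr_gt0 //.
  by move: hQ; rewrite v_0; lra.
apply: (@le_trans _ _ (\int[mu]_z ((4 / 3)%:E * (expR ((z - m) ^+ 2 / (4 * v)))%:E))%E).
  apply: ge0_le_integral => //.
  - exact/measurable_EFinP.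
  - by apply/measurable_EFinP; apply: measurable_funM => //; exact: measurable_centered_exp.
  move=> z _; rewrite -EFinM lee_fin.
  apply: le_trans (_ : expR (4^-1) * expR ((z - m) ^+ 2 / (4 * v)) <= _); last first.
    by rewrite ler_wpM2r ?expR_ge0 // expR_quarter_le.
  rewrite -expRD ler_expR.
  have h1 : (z - m) ^+ 2 / (4 * Q) <= (z - m) ^+ 2 / (4 * v).
    rewrite ler_wpM2l ?sqr_ge0 // lef_pV2 ?posrE ?mulr_gt0 //.
    by rewrite ler_pM2l //; have := sqr_ge0 m; lra.
  apply: le_trans (_ : 4^-1 + (z - m) ^+ 2 / (4 * Q) <= _); last by rewrite lerD2l.
  rewrite ler_pdivrMr ?mulr_gt0 //.
  have -> : (4^-1 + (z - m) ^+ 2 / (4 * Q)) * (8 * Q) = 2 * Q + 2 * (z - m) ^+ 2.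
    by field; rewrite gt_eqF.
  have := sqr_ge0 (z - 2 * m); nra.
rewrite ge0_integralZl //; last first.
  by apply/measurable_EFinP; exact: measurable_centered_exp.
apply: le_trans (_ : (4 / 3)%:E * (3 / 2)%:E <= _)%E.
  by apply: lee_wpmul2l; rewrite ?lee_fin //; exact: normal_law_centered_exp.
by rewrite -EFinM lee_fin; lra.
Qed.

Lemma normal_law_setT : mu setT = 1%E.
Proof.
rewrite hmu // /normal_law; case: ifP => _; first by rewrite diracT.
exact: probability_setT.
Qed.

Let integral_ge_cst c (f : R -> R) : (forall z, c <= f z) -> 0 <= c ->
  measurable_fun setT f -> (c%:E <= \int[mu]_z (f z)%:E)%E.
Proof.
move=> cf c0 mf; rewrite -[leLHS]mule1 -normal_law_setT -integral_cst //.
apply: ge0_le_integral => //; first exact/measurable_EFinP.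
by move=> z _; rewrite lee_fin.
Qed.

(** The interval has length [s], and the density is at most its peak, which is below [1 / (2 * s)]
    because [pi >= 2]. *)
Lemma normal_law_near0_le : 0 < v ->
  (mu `[(- (s / 2))%R, (s / 2)%R]%classic <= (2^-1)%:E)%E.
Proof.
move=> v_gt0; have s0 : 0 < s by rewrite sqrtr_gt0.
rewrite hmu // /normal_law gt_eqF // /normal_prob.
apply: (@le_trans _ _ (\int[leb]_(z in `[(- (s / 2))%R, (s / 2)%R]%classic)
    (normal_peak s)%:E)%E).
  apply: ge0_le_integral => //.
  - by move=> z _; rewrite lee_fin normal_pdf_ge0.
  - by apply: measurable_funTS; apply/measurable_EFinP; exact: measurable_normal_pdf.
  - by move=> z _; rewrite lee_fin normal_pdf_ub // gt_eqF.
rewrite integral_cst //= lebesgue_measure_itv /= lte_fin.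
have -> : - (s / 2) < s / 2 by have := s0; lra.
rewrite -EFinD -EFinM lee_fin opprK -splitr /normal_peak.
set k := Num.sqrt _.
have k0 : 0 < k.
  by rewrite sqrtr_gt0 mulrn_wgt0 // mulr_gt0 ?pi_gt0 // exprn_gt0.
have : 2 * s <= k.
  have s20 : 0 <= 2 * s by rewrite mulr_ge0 // ltW.
  rewrite -(ger0_norm s20) -sqrtr_sqr /k ler_wsqrtr //.
  rewrite mulr2n; have := pi_ge2 R; have := exprn_gt0 2 s0; nra.
by move=> h; rewrite ler_pdivrMl // ler_pdivlMr // mulrC.
Qed.

(* Only the order of magnitude of the second moment is needed: an interval of
   length sqrt v has probability at most 1/2, and E (z - m)^2 = O(v). *)
Lemma normal_law_second_moment_ge q :
  (\int[mu]_z (z ^+ 2)%:E = q%:E)%E -> m ^+ 2 + v <= 106 * q.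
Proof.
move=> hq; move: v0; rewrite le_eqVlt => /predU1P[/esym v_0|v_gt0].
  move: hq; rewrite normal_law_integral0 //; last first.
    by apply/measurable_EFinP; exact: measurable_funX.
  by move=> -[<-]; rewrite v_0; have := sqr_ge0 m; lra.
have s0 : 0 < s by rewrite sqrtr_gt0.
have s2 : s ^+ 2 = v by rewrite sqr_sqrtr.
have mX : measurable_fun setT (fun z : R => (z ^+ 2)%:E).
  by apply/measurable_EFinP; exact: measurable_funX.
have vq : v <= 8 * q.
  pose A := `[(- (s / 2))%R, (s / 2)%R]%classic.
  have mA : measurable A by exact: measurable_itv.
  have mI : measurable_fun setT (fun z : R => v / 4 * \1_A z).
    by apply: measurable_funM => //; exact: (measurable_indic mA).
  (* Outside [A] one has [z ^+ 2 >= v / 4]. As [A] has mass at most 1/2, integrating gives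
     [v / 4 <= q + v / 8]. *)
  have h : ((v / 4)%:E <= \int[mu]_z (z ^+ 2 + v / 4 * \1_A z)%:E)%E.
    apply: integral_ge_cst; last 2 first.
    - by rewrite divr_ge0 // ltW.
    - by apply: measurable_funD => //; exact: measurable_funX.
    move=> z; rewrite indicE; case: (boolP (z \in A)) => zA.
      by rewrite mulr1 lerDr sqr_ge0.
    rewrite mulr0 addr0 -s2; move: zA; rewrite notin_setE /A /= in_itv /=.
    move=> /negP; rewrite negb_and -!ltNge => /orP[] h.
      have := s0; nra.
    have := s0; nra.
  move: h; under eq_integral do rewrite EFinD (EFinM (v / 4)).
  rewrite ge0_integralD //; last 3 first.
  - by move=> z _; rewrite lee_fin sqr_ge0.
  - by move=> z _; rewrite mule_ge0 // lee_fin // divr_ge0 // ltW.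
  - by under eq_fun do rewrite -EFinM; exact/measurable_EFinP.
  rewrite ge0_integralZl ?lee_fin ?divr_ge0 ?(ltW v_gt0) //; last first.
    by apply/measurable_EFinP; exact: measurable_indic.
  rewrite integral_indic // setIT hq.
  have := normal_law_near0_le v_gt0; rewrite -/A => hA h.
  have : ((v / 4)%:E <= q%:E + (v / 4)%:E * (2^-1)%:E)%E.
    apply: le_trans h _; apply: leeD => //; apply: lee_wpmul2l => //.
    by rewrite lee_fin divr_ge0 // ltW.
  by rewrite -EFinM -EFinD lee_fin; lra.
(* From [m ^+ 2 <= 2 * z ^+ 2 + 2 * (z - m) ^+ 2] and [(z - m) ^+ 2 <= 4 * v * g z]. With
   [v <= 8 * q] the total is [2 + 96 + 8 = 106] times [q]. *)
suff : m ^+ 2 <= 2 * q + 8 * v * (3 / 2) by lra.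
pose g (z : R) := expR ((z - m) ^+ 2 / (4 * v)).
have mg : measurable_fun setT g := measurable_centered_exp.
have h : ((m ^+ 2)%:E <= \int[mu]_z (2 * z ^+ 2 + 8 * v * g z)%:E)%E.
  apply: integral_ge_cst; last 2 first.
  - exact: sqr_ge0.
  - by apply: measurable_funD => //; apply: measurable_funM => //.
  move=> z.
  have h1 : (z - m) ^+ 2 / (4 * v) <= g z by apply: le_trans (expR_ge1Dx _); lra.
  have : 8 * v * ((z - m) ^+ 2 / (4 * v)) <= 8 * v * g z.
    by rewrite ler_wpM2l // mulr_ge0 // ltW.
  have -> : 8 * v * ((z - m) ^+ 2 / (4 * v)) = 2 * (z - m) ^+ 2.
    by field; rewrite gt_eqF.
  have := sqr_ge0 (2 * z - m); nra.
move: h; under eq_integral do rewrite EFinD (EFinM 2) (EFinM (8 * v)).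
rewrite ge0_integralD //; last 4 first.
- by move=> z _; rewrite mule_ge0 // lee_fin // sqr_ge0.
- by apply: measurable_funeM.
- by move=> z _; rewrite mule_ge0 // lee_fin ?expR_ge0 // mulr_ge0 // ltW.
- by apply: measurable_funeM; exact/measurable_EFinP.
have v8 : 0 <= 8 * v by rewrite mulr_ge0.
rewrite !ge0_integralZl ?lee_fin //; try exact/measurable_EFinP;
  try by move=> z _; rewrite lee_fin ?sqr_ge0 ?expR_ge0.
rewrite hq => /le_trans h; rewrite -lee_fin; apply: h.
rewrite (EFinD (2 * q)) (EFinM 2) (EFinM (8 * v)); apply: leeD2l; apply: lee_wpmul2l.
  by rewrite lee_fin mulr_ge0 // ltW.
exact: normal_law_centered_exp.
Qed.
End gaussian_moments.

(** * Concentration *)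

Section concentration.
Context {R : realType} {d : measure_display} {T : measurableType d}.

Lemma markov_ge0 (P : {measure set T -> \bar R}) (g : T -> R) (A : set T) (B c : R) :
  0 < c -> measurable A -> measurable_fun setT g -> (forall w, 0 <= g w) ->
  (forall w, A w -> c <= g w) -> (\int[P]_w (g w)%:E <= B%:E)%E ->
  (P A <= (B / c)%:E)%E.
Proof.
move=> c0 mA mg g0 cg gB.
have : (c%:E * P A <= B%:E)%E.
  apply: le_trans gB.
  rewrite -(setIT A) -integral_indic // -ge0_integralZl ?lee_fin ?(ltW c0) //; last first.
    by apply/measurable_EFinP; exact: measurable_indic.
  apply: ge0_le_integral => //.
  - by move=> w _; rewrite -EFinM lee_fin mulr_ge0 // ltW.
  - under eq_fun do rewrite -EFinM; apply/measurable_EFinP.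
    by apply: measurable_funM => //; exact: measurable_indic.
  - exact/measurable_EFinP.
  move=> w _; rewrite -EFinM lee_fin indicE; case: (boolP (w \in A)) => [/[!inE] wA|_].
    by rewrite mulr1; exact: cg.
  by rewrite mulr0.
by rewrite muleC -lee_pdivlMr // EFinM.
Qed.

Variable P : probability T R.

Let K : R := 32 * expR 1.

(** The linear term of [expR_le_quadratic] integrates to 0. In the remainder, with [D = y - a],
    [D ^+ 2] and [expR |t D|] contribute [16 * expR (|D| / 2)] and [expR (|D| / 2)]. Since
    [0 <= a <= 1] gives [|D| <= 1 + y], and [expR y] has mean at most 2, the constant is
    [16 * 2 * expR 1], that is [K]. *)
Lemma centered_mgf_le (y : T -> R) (a t : R) :
  measurable_fun setT y -> (forall w, 0 <= y w) ->
  (\int[P]_w (expR (y w))%:E <= 2%:E)%E -> (\int[P]_w (y w)%:E = a%:E)%E ->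
  `|t| <= 2^-1 ->
  (\int[P]_w (expR (t * (y w - a)))%:E <= (expR (K * t ^+ 2))%:E)%E.
Proof.
move=> my y0 hy ha ht.
have mey : measurable_fun setT (fun w => expR (y w)) by exact: measurableT_comp.
have a0 : 0 <= a by rewrite -lee_fin -ha; apply: integral_ge0 => w _; rewrite lee_fin.
have a1 : a <= 1.
  have : (1%:E + a%:E <= 2%:E)%E.
    have i1 : (\int[P]_w 1%:E = 1%:E :> \bar R)%E.
      by rewrite integral_cst //= probability_setT mule1.
    apply: le_trans hy; rewrite -ha -i1 -ge0_integralD //; last 2 first.
    - by move=> w _; rewrite lee_fin.
    - exact/measurable_EFinP.
    apply: ge0_le_integral => //.
    - by move=> w _; rewrite -EFinD lee_fin addr_ge0.
    - by apply/measurable_EFinP; exact: measurable_funD.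
    - exact/measurable_EFinP.
    - by move=> w _; rewrite -EFinD lee_fin expR_ge1Dx.
  by rewrite -EFinD lee_fin; lra.
have iey : P.-integrable setT (EFin \o (fun w => expR (y w))).
  apply/integrableP; split; first exact/measurable_EFinP.
  under eq_integral do rewrite /= ger0_norm ?expR_ge0 //.
  by apply: le_lt_trans hy _; rewrite ltry.
have iy : P.-integrable setT (EFin \o y).
  apply/integrableP; split; first exact/measurable_EFinP.
  under eq_integral do rewrite /= ger0_norm //.
  by rewrite /= ha ltry.
pose c := 16 * t ^+ 2 * expR 1.
pose U w := (1 - t * a) + (t * y w + c * expR (y w)).
have mU : measurable_fun setT U.
  apply: measurable_funD => //; apply: measurable_funD; exact: measurable_funM.
have it : P.-integrable setT (fun w => t%:E * (y w)%:E)%E.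
  exact: (integrableZl measurableT t iy).
have ic : P.-integrable setT (fun w => c%:E * (expR (y w))%:E)%E.
  exact: (integrableZl measurableT c iey).
have hU w : expR (t * (y w - a)) <= U w.
  set D := y w - a.
  apply: le_trans (expR_le_quadratic _) _.
  have -> : U w = 1 + t * D + c * expR (y w) by rewrite /U /D; ring.
  rewrite lerD2l exprMn normrM -real_normK ?num_real // -[D ^+ 2]real_normK ?num_real //.
  rewrite /c real_normK ?num_real //.
  have h1 := sqr_le_expR (normr_ge0 D).
  have h2 : expR (`|t| * `|D|) <= expR (`|D| / 2).
    by rewrite ler_expR mulrC ler_wpM2l.
  have h3 : expR (`|D| / 2) * expR (`|D| / 2) <= expR 1 * expR (y w).
    rewrite -!expRD ler_expR -splitr ler_norml /D; have := y0 w; lra.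
  have h4 : `|D| ^+ 2 * expR (`|t| * `|D|) <= 16 * (expR 1 * expR (y w)).
    apply: le_trans (_ : 16 * expR (`|D| / 2) * expR (`|D| / 2) <= _); last first.
      by rewrite -mulrA ler_pM2l.
    by apply: ler_pM => //; rewrite ?expR_ge0 // sqr_ge0.
  have := ler_wpM2l (sqr_ge0 t) h4; lra.
apply: (@le_trans _ _ (\int[P]_w (U w)%:E)%E).
  apply: ge0_le_integral => //.
  - apply/measurable_EFinP; apply: measurableT_comp => //.
    by apply: measurable_funM => //; exact: measurable_funB.
  - exact/measurable_EFinP.
  - by move=> w _; rewrite lee_fin.
have -> : (\int[P]_w (U w)%:E = (1 - t * a)%:E + (t%:E * a%:E +
   c%:E * \int[P]_w (expR (y w))%:E))%E.
  transitivity (\int[P]_w ((1 - t * a)%:E +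
      (t%:E * (y w)%:E + c%:E * (expR (y w))%:E)))%E.
    by apply: eq_integral => w _; rewrite /U !EFinD !EFinM.
  rewrite integralD //=; last 2 first.
  - exact: (finite_measure_integrable_cst P (1 - t * a) measurableT).
  - exact: (integrableD measurableT it ic).
  rewrite integral_cst //= probability_setT mule1 integralD //.
  by rewrite !integralZl // ha.
apply: le_trans (_ : (1 - t * a)%:E + (t%:E * a%:E + c%:E * 2%:E) <= _)%E.
  rewrite !leeD2l //; apply: lee_wpmul2l => //.
  by rewrite lee_fin /c mulr_ge0 ?expR_ge0 // mulr_ge0 ?sqr_ge0.
rewrite -!EFinM -!EFinD lee_fin; apply: le_trans (expR_ge1Dx _).
rewrite /c /K; lra.
Qed.

Lemma subexponential_chernoff {d1 : measure_display} {T1 : measurableType d1}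
    n (Z : 'I_n -> T -> T1) (y : T1 -> R) (a u : R) :
  (forall i, measurable_fun setT (Z i)) -> mutually_independent_rv P Z ->
  measurable_fun setT y -> (forall z, 0 <= y z) ->
  (forall i, \int[P]_w (expR (y (Z i w)))%:E <= 2%:E)%E ->
  (forall i, \int[P]_w (y (Z i w))%:E = a%:E)%E ->
  0 <= u <= K ->
  (P [set w | (n%:R * u <= `|\sum_i (y (Z i w) - a)|)%R] <=
     (2 * expR (- (n%:R * u ^+ 2 / (4 * K))))%:E)%E.
Proof.
move=> mZ indep my y0 hy ha /andP[u0 uK].
have K0 : 0 < K by rewrite mulr_gt0 ?expR_gt0.
have myZ i : measurable_fun setT (fun w => y (Z i w)) := measurableT_comp my (mZ i).
have mS : measurable_fun setT (fun w => \sum_i (y (Z i w) - a)).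
  by apply: measurable_sum => i; exact: measurable_funB.
pose A (g : R) := [set w | n%:R * u <= g * \sum_i (y (Z i w) - a)].
have mA g : measurable (A g).
  rewrite -[A g]setTI.
  apply: (measurable_fun_ler (f := cst (n%:R * u))
    (g := fun w => g * \sum_i (y (Z i w) - a)) _ _ measurableT (Y := [set true])) => //.
  exact: measurable_funM.
have H g : `|g| = 1 -> (P (A g) <= (expR (- (n%:R * u ^+ 2 / (4 * K))))%:E)%E.
  (* The minimiser of [K * t ^+ 2 - |t| * u], with the sign [g] selecting the tail; [u <= K] is
     exactly [|t| <= 1/2]. *)
  move=> g1; pose t := g * (u / (2 * K)).
  have t1 : `|t| <= 2^-1.
    rewrite normrM g1 mul1r ger0_norm; last by rewrite divr_ge0 // mulr_ge0 // ltW.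
    by rewrite ler_pdivrMr ?mulr_gt0 // mulrA mulVf // mul1r.
  have tt : t ^+ 2 = (u / (2 * K)) ^+ 2.
    by rewrite exprMn -[g ^+ 2]real_normK ?num_real // g1 expr1n mul1r.
  pose F (z : T1) := expR (t * (y z - a)).
  have mF : measurable_fun setT F.
    by apply: measurableT_comp => //; apply: measurable_funM => //; exact: measurable_funB.
  have FZ i : (\int[P]_w (F (Z i w))%:E <= (expR (K * t ^+ 2))%:E)%E.
    exact: centered_mgf_le.
  pose E i := fine (\int[P]_w (F (Z i w))%:E)%E.
  have F0 i : (0 <= \int[P]_w (F (Z i w))%:E)%E.
    by apply: integral_ge0 => w _; rewrite lee_fin expR_ge0.
  have EF i : (\int[P]_w (F (Z i w))%:E = (E i)%:E)%E.
    by rewrite fineK // ge0_fin_numE // (le_lt_trans (FZ i)) ?ltry.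
  have prodF w : \prod_i F (Z i w) = expR (t * \sum_i (y (Z i w) - a)).
    by rewrite mulr_sumr expR_sum.
  apply: le_trans (_ : (expR (n%:R * (K * t ^+ 2)) / expR (u / (2 * K) * (n%:R * u)))%:E <= _)%E.
    apply: (markov_ge0 (g := fun w => \prod_i F (Z i w))) => //.
    - exact: expR_gt0.
    - under eq_fun do rewrite prodF.
      by apply: measurableT_comp => //; exact: measurable_funM.
    - by move=> w; rewrite prodF expR_ge0.
    - move=> w Aw; rewrite prodF ler_expR /t.
      rewrite [leRHS](_ : _ = u / (2 * K) * (g * \sum_i (y (Z i w) - a)));
        last by ring.
      rewrite ler_wpM2l //.
      by rewrite divr_ge0 // mulr_ge0 // ltW.
    rewrite (integral_prod_independent (F := fun _ => F) (E := E)) //; last first.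
      by move=> i z; exact: expR_ge0.
    rewrite lee_fin.
    have -> : n%:R * (K * t ^+ 2) = \sum_(i < n) (K * t ^+ 2).
      by rewrite sumr_const card_ord mulr_natl.
    rewrite expR_sum; apply: ler_prod => i _.
    by rewrite -!lee_fin -EF FZ F0.
  rewrite lee_fin -expRN -expRD ler_expR tt le_eqVlt; apply/orP; left; apply/eqP.
  by field; rewrite gt_eqF.
apply: (@le_trans _ _ (P (A 1 `|` A (-1)))).
  apply: le_measure; rewrite ?inE.
  - rewrite -[X in measurable X]setTI.
    apply: (measurable_fun_ler (f := cst (n%:R * u))
      (g := fun w => `|\sum_i (y (Z i w) - a)|) _ _ measurableT (Y := [set true])) => //.
    exact: measurableT_comp.
  - exact: measurableU.
  move=> w /=; rewrite ler_normr => /orP[h|h]; [left|right]; rewrite /A /=.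
    by rewrite mul1r.
  by rewrite mulN1r.
apply: le_trans (measureU2 _ _ _) _ => //.
rewrite mulr2n mulrDl mul1r EFinD; apply: leeD; apply: H; first exact: normr1.
exact: normrN1.
Qed.

End concentration.

Section gaussian_linear_model.
Context {R : realType} {d : measure_display} {T : measurableType d}
  (P : probability T R).

Lemma union_bound (I : finType) (A : I -> set T) (c : R) :
  (forall i, measurable (A i)) -> (forall i, P (A i) <= c%:E)%E ->
  (P (\bigcup_(i in [set: I]) A i) <= (#|I|%:R * c)%:E)%E.
Proof.
move=> mA Ac.
have -> : \bigcup_(i in [set: I]) A i = \big[setU/set0]_(i <- enum I) A i.
  rewrite -bigcup_seq; apply/seteqP; split => w [i _ Aiw]; exists i => //=.
  by rewrite mem_enum.
rewrite cardT mulr_natl; elim: (enum I) => [|i s IH] /=.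
  by rewrite big_nil measure0 mulr0n.
rewrite big_cons mulrS EFinD; apply: le_trans (leeD (Ac i) IH).
by apply: measureU2 => //; exact: bigsetU_measurable.
Qed.

Definition law (z : T -> R) (mz : measurable_fun setT z) : {measure set R -> \bar R} :=
  distribution P (HB.pack z (isMeasurableFun.Build _ _ _ _ _ mz) : {RV P >-> R}).

Lemma integral_law z (mz : measurable_fun setT z) (f : R -> \bar R) :
  measurable_fun setT f -> (forall x, 0 <= f x)%E ->
  (\int[law mz]_x f x = \int[P]_w f (z w))%E.
Proof. by move=> mf f0; rewrite /law /distribution ge0_integral_pushforward. Qed.

(** Markov's inequality for the exponential of the square, which covers the degenerate case [v = 0]
    as well; the price is an 8 in place of the sharp 2. *)
Lemma normal_law_tail z (mz : measurable_fun setT z) (v V u : R) :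
  0 <= v <= V -> 0 < V -> 0 <= u ->
  (forall B, measurable B -> P (z @^-1` B) = normal_law 0 v B) ->
  (P [set w | (u <= `|z w|)%R] <= (2 * expR (- (u ^+ 2 / (8 * V))))%:E)%E.
Proof.
move=> /andP[v0 vV] V0 u0 hz.
have mE : measurable_fun setT (fun w => expR (z w ^+ 2 / (8 * V))).
  exact: measurableT_comp (measurable_expR_sqr _) mz.
rewrite expRN; apply: (markov_ge0 (g := fun w => expR (z w ^+ 2 / (8 * V)))) => //.
- exact: expR_gt0.
- rewrite -[X in measurable X]setTI.
  apply: (measurable_fun_ler (f := cst u) (g := fun w => `|z w|) _ _ measurableT
    (Y := [set true])) => //.
  exact: measurableT_comp.
- move=> w /= uz; rewrite ler_expR ler_wpM2r ?invr_ge0 ?mulr_ge0 ?(ltW V0) //.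
  by rewrite -[leRHS]real_normK ?num_real // ler_sqr ?nnegrE.
rewrite -(integral_law mz (f := fun x => (expR (x ^+ 2 / (8 * V)))%:E)) //.
- by apply: (@normal_law_sqr_exp _ _ 0 v) => //; rewrite expr0n add0r.
- by apply/measurable_EFinP; exact: measurable_expR_sqr.
Qed.


Context {n p : nat}.
Variable X : {RV P >-> 'M[R]_(n, p)}.
Hypotheses (n0 : (0 < n)%N) (rowsX : iid_gaussian_rows P X).

Let Sig := inner_product_mx P X.

Let mX : measurable_fun setT X := measurable_funPT X.

Let mlin (t : 'rV[R]_p) i : measurable_fun setT (fun w => (t *m (row i (X w))^T) 0 0).
Proof.
apply: (measurable_mxcoord (f := fun w => t *m (row i (X w))^T)).
apply: measurable_mulmx => //; apply: measurable_mx => k l.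
by under eq_fun do rewrite !mxE; exact: measurable_mxcoord.
Qed.

Lemma gram_form_mean (x : 'M[R]_(n, p)) (u : 'cV[R]_p) :
  bil (gram x) u u = n%:R^-1 * \sum_i ((u^T *m (row i x)^T) 0 0) ^+ 2.
Proof.
rewrite bil_gram dot_sqnorm2 mulrC; congr (_ * _); apply: eq_bigr => i _.
congr (_ ^+ 2); rewrite !mxE; apply: eq_bigr => k _.
by rewrite !mxE mulrC.
Qed.

Let row_law : exists (mu : 'cV[R]_p) (V : 'M[R]_p), [/\
  forall t : 'rV[R]_p, 0 <= (t *m V *m t^T) 0 0 &
  forall (t : 'rV[R]_p) i B, measurable B ->
    law (mlin t i) B = normal_law ((t *m mu) 0 0) ((t *m V *m t^T) 0 0) B].
Proof.
have [_ [mu [V hV]]] := rowsX; exists mu, V; split.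
  by have [_ h _] := hV (Ordinal n0).
by move=> t i B mB; have [_ _ h] := hV i; rewrite -h.
Qed.

(** Trades the unknown mean and variance of a linear form of a row for its second moment [q], the
    quantity that [Sig] controls; 106 comes from [normal_law_second_moment_ge]. *)
Lemma row_second_moment (u : 'cV[R]_p) : exists2 q : R,
  (forall i, \int[P]_w (((u^T *m (row i (X w))^T) 0 0) ^+ 2)%:E = q%:E)%E &
  forall Q i, 0 < Q -> 106 * q <= Q ->
   (\int[P]_w (expR (((u^T *m (row i (X w))^T) 0 0) ^+ 2 / (8 * Q)))%:E <= 2%:E)%E.
Proof.
have [mu [V [V0 hlaw]]] := row_law.
set t := u^T; set m := (t *m mu) 0 0; set v := (t *m V *m t^T) 0 0.
have v0 : 0 <= v := V0 t.
have msq : measurable_fun setT (fun x : R => (x ^+ 2)%:E).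
  by apply/measurable_EFinP; exact: measurable_funX.
have sq0 (x : R) : (0 <= (x ^+ 2)%:E)%E by rewrite lee_fin sqr_ge0.
have iexp Q i : 0 < Q -> m ^+ 2 + v <= Q ->
    (\int[P]_w (expR (((t *m (row i (X w))^T) 0 0) ^+ 2 / (8 * Q)))%:E <= 2%:E)%E.
  move=> Q0 hQ.
  rewrite -(integral_law (mlin t i) (f := fun x => (expR (x ^+ 2 / (8 * Q)))%:E)) //.
  - by apply: (@normal_law_sqr_exp _ _ m v) => // B mB; exact: hlaw.
  - by apply/measurable_EFinP; exact: measurable_expR_sqr.
have sqE i : (\int[P]_w (((t *m (row i (X w))^T) 0 0) ^+ 2)%:E =
    \int[law (mlin t i)]_x (x ^+ 2)%:E)%E.
  by rewrite (integral_law (mlin t i) (f := fun x => (x ^+ 2)%:E)).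
have eqE i : (\int[law (mlin t i)]_x (x ^+ 2)%:E =
    \int[law (mlin t (Ordinal n0))]_x (x ^+ 2)%:E)%E.
  by apply: eq_measure_integral => B mB _; transitivity (normal_law m v B);
    [|apply: esym]; exact: hlaw.
pose q := fine (\int[law (mlin t (Ordinal n0))]_x (x ^+ 2)%:E)%E.
(* A scale at which the exponential moment shows that the second moment is finite; the extra 1 keeps
   it positive for a law concentrated at 0. *)
pose Q0 := m ^+ 2 + v + 1.
have mv0 : 0 <= m ^+ 2 + v by rewrite addr_ge0 ?sqr_ge0.
have Q00 : 0 < Q0 by rewrite ltr_wpDl.
have qE : (\int[law (mlin t (Ordinal n0))]_x (x ^+ 2)%:E = q%:E)%E.
  rewrite fineK // ge0_fin_numE; last by apply: integral_ge0.
  rewrite -sqE; apply: (@le_lt_trans _ _ (\int[P]_w ((8 * Q0)%:E *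
    (expR (((t *m (row (Ordinal n0) (X w))^T) 0 0) ^+ 2 / (8 * Q0)))%:E))%E).
    apply: ge0_le_integral => //.
    - by apply/measurable_EFinP; exact: measurable_funX.
    - under eq_fun do rewrite -EFinM; apply/measurable_EFinP.
      apply: measurable_funM => //.
      exact: measurableT_comp (measurable_expR_sqr _) (mlin _ _).
    - move=> w _; rewrite -EFinM lee_fin -ler_pdivrMl ?mulr_gt0 // mulrC.
      by apply: le_trans (expR_ge1Dx _); rewrite lerDr.
  rewrite ge0_integralZl ?lee_fin ?mulr_ge0 ?(ltW Q00) //; last first.
    apply/measurable_EFinP.
    exact: measurableT_comp (measurable_expR_sqr _) (mlin _ _).
  apply: le_lt_trans (lee_wpmul2l _ (iexp Q0 _ Q00 _)) _.
  - by rewrite lee_fin mulr_ge0 // ltW.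
  - by rewrite lerDl.
  - by rewrite -EFinM ltry.
exists q => [i|Q i Qpos hQ]; first by rewrite sqE eqE qE.
apply: iexp => //; apply: le_trans hQ.
apply: normal_law_second_moment_ge qE => //.
by move=> B mB; exact: hlaw.
Qed.

End gaussian_linear_model.

(** * Concentration of the Gram matrix *)

Section gram_concentration.
Context {R : realType} {d : measure_display} {T : measurableType d}
  (P : probability T R) {n p : nat}.
Variable X : {RV P >-> 'M[R]_(n, p)}.
Hypotheses (n0 : (0 < n)%N) (rowsX : iid_gaussian_rows P X).

Let Sig := inner_product_mx P X.

Let mX : measurable_fun setT X := measurable_funPT X.

Lemma gramE (x : 'M[R]_(n, p)) j k :
  gram x j k = n%:R^-1 * \sum_i x i j * x i k.
Proof. by rewrite !mxE; congr (_ * _); apply: eq_bigr => i _; rewrite mxE. Qed.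

Lemma trmx_gram (x : 'M[R]_(n, p)) : (gram x)^T = gram x.
Proof. by rewrite /gram linearZ /= trmx_mul trmxK. Qed.

Lemma measurable_gram : measurable_fun setT (fun w => gram (X w)).
Proof.
by apply: measurable_scalemx; apply: measurable_mulmx => //; exact: measurable_trmx.
Qed.

Lemma measurable_bil_gram (u v : 'cV[R]_p) :
  measurable_fun setT (fun w => bil (gram (X w)) u v).
Proof.
apply: (measurable_mxcoord (f := fun w => u^T *m gram (X w) *m v)).
apply: measurable_mulmx => //; apply: measurable_mulmx => //.
exact: measurable_gram.
Qed.

Let row_delta (x : 'M[R]_(n, p)) i (k : 'I_p) :
  ((delta_mx k 0 : 'cV[R]_p)^T *m (row i x)^T) 0 0 = x i k.
Proof. by rewrite trmx_delta -rowE !mxE. Qed.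

(** [inner_product_mx] goes through [fine], so integrability is what makes its entries genuine
    expectations. *)
Lemma integrable_gram j k :
  P.-integrable setT (fun w => (gram (X w) j k)%:E).
Proof.
have iX i l : P.-integrable setT (fun w => ((X w i l) ^+ 2)%:E).
  have [q hq _] := row_second_moment n0 rowsX (delta_mx l 0).
  apply/integrableP; split.
    by apply/measurable_EFinP; apply: measurable_funX; exact: measurable_mxcoord.
  rewrite (_ : (\int[P]_w _ = q%:E)%E) ?ltry // -(hq i).
  by apply: eq_integral => w _; rewrite row_delta /= ger0_norm ?sqr_ge0.
under eq_fun do rewrite gramE EFinM -sumEFin.
apply: integrableZl => //; apply: integrable_sum => // i _.
apply: (le_integrable measurableT _ _ (integrableD measurableT (iX i j) (iX i k))).
  by apply/measurable_EFinP; apply: measurable_funM; exact: measurable_mxcoord.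
move=> w _; rewrite /= lee_fin [leRHS]ger0_norm ?addr_ge0 ?sqr_ge0 //.
set a := X w i j; set b := X w i k.
rewrite ler_norml; have := sqr_ge0 (a - b); have := sqr_ge0 (a + b).
by move=> ? ?; apply/andP; split; nra.
Qed.

Lemma integral_gram j k : (\int[P]_w (gram (X w) j k)%:E = (Sig j k)%:E)%E.
Proof.
rewrite /Sig mxE fineK; first by rewrite unlock.
by rewrite unlock; apply: integrable_fin_num => //; exact: integrable_gram.
Qed.

Lemma trmx_inner_product : Sig^T = Sig.
Proof.
apply/matrixP => j k; rewrite mxE; apply: EFin_inj; rewrite -!integral_gram.
by apply: eq_integral => w _; rewrite -{1}trmx_gram mxE.
Qed.

Lemma integral_bil_gram (u : 'cV[R]_p) :
  (\int[P]_w (bil (gram (X w)) u u)%:E = (bil Sig u u)%:E)%E.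
Proof.
have E (A : 'M[R]_p) : bil A u u =
    \sum_(jk : 'I_p * 'I_p) u jk.1 0 * u jk.2 0 * A jk.1 jk.2.
  rewrite bilE pair_big /=; apply: eq_bigr => jk _; ring.
under eq_integral do rewrite E -sumEFin.
rewrite integral_sum //; last first.
  move=> jk; under eq_fun do rewrite EFinM.
  by apply: integrableZl => //; exact: integrable_gram.
rewrite E -sumEFin; apply: eq_bigr => jk _.
under eq_integral do rewrite EFinM.
by rewrite integralZl ?integral_gram //; exact: integrable_gram.
Qed.

Lemma inner_product_ge0 (u : 'cV[R]_p) : 0 <= bil Sig u u.
Proof.
rewrite -lee_fin -integral_bil_gram; apply: integral_ge0 => w _.
by rewrite lee_fin bil_gram dot_sqnorm2 divr_ge0 ?sqnorm2_ge0.
Qed.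

Let n0R : 0 < n%:R :> R. Proof. by rewrite ltr0n. Qed.

Lemma row_second_momentE (u : 'cV[R]_p) i :
  (\int[P]_w (((u^T *m (row i (X w))^T) 0 0) ^+ 2)%:E = (bil Sig u u)%:E)%E.
Proof.
have [q hq _] := row_second_moment n0 rowsX u.
rewrite hq; congr (_%:E); apply: EFin_inj; rewrite -integral_bil_gram.
under eq_integral do rewrite gram_form_mean EFinM -sumEFin.
have mz l : measurable_fun setT (fun w => (((u^T *m (row l (X w))^T) 0 0) ^+ 2)%:E).
  apply/measurable_EFinP; apply: measurable_funX.
  apply: (measurable_mxcoord (f := fun w => u^T *m (row l (X w))^T)).
  apply: measurable_mulmx => //; apply: measurable_mx => k l'.
  by under eq_fun do rewrite !mxE; exact: measurable_mxcoord.
rewrite ge0_integralZl ?lee_fin ?invr_ge0 //; last 2 first.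
- exact: emeasurable_sum.
- by move=> w _; apply: sume_ge0 => l _; rewrite lee_fin sqr_ge0.
rewrite ge0_integral_sum //; last by move=> l w _; rewrite lee_fin sqr_ge0.
rewrite (eq_bigr (fun=> q%:E)) // sumEFin sumr_const card_ord -EFinM.
by rewrite -[q *+ n]mulr_natl mulrA mulVf ?mul1r // gt_eqF.
Qed.

Let K : R := 32 * expR 1.

(** The Chernoff bound for the squared row forms divided by [8 * Q], the scale at which their
    exponential moment is at most 2; undoing the scaling produces [8 * Q * w0]. *)
Lemma gram_form_deviation (u : 'cV[R]_p) Q w0 :
  0 < Q -> 106 * bil Sig u u <= Q -> 0 <= w0 <= K ->
  (P [set w | (8 * Q * w0 <= `|bil (gram (X w) - Sig) u u|)%R] <=
     (2 * expR (- (n%:R * w0 ^+ 2 / (4 * K))))%:E)%E.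
Proof.
move=> Q0 hQ hw.
have [q hq hexp] := row_second_moment n0 rowsX u.
have qS : q = bil Sig u u.
  by apply: EFin_inj; rewrite -(hq (Ordinal n0)) row_second_momentE.
pose y (r : 'rV[R]_p) := ((u^T *m r^T) 0 0) ^+ 2 / (8 * Q).
have my : measurable_fun setT y.
  apply: measurable_funM => //; apply: measurable_funX.
  apply: (measurable_mxcoord (f := fun r : 'rV[R]_p => u^T *m r^T)).
  by apply: measurable_mulmx => //; exact: measurable_trmx.
have mrow i : measurable_fun setT (fun w => row i (X w)).
  apply: measurable_mx => k l; under eq_fun do rewrite mxE.
  exact: measurable_mxcoord.
have y0 r : 0 <= y r by rewrite divr_ge0 ?sqr_ge0 // mulr_ge0 // ltW.
have h1 i : (\int[P]_w (expR (y (row i (X w))))%:E <= 2%:E)%E.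
  by apply: hexp => //; rewrite qS.
have h2 i : (\int[P]_w (y (row i (X w)))%:E = (bil Sig u u / (8 * Q))%:E)%E.
  rewrite /y; under eq_integral do rewrite EFinM.
  rewrite ge0_integralZr ?lee_fin ?invr_ge0 ?mulr_ge0 ?(ltW Q0) //; last 2 first.
  - apply/measurable_EFinP; apply: measurable_funX.
    apply: (measurable_mxcoord (f := fun w => u^T *m (row i (X w))^T)).
    by apply: measurable_mulmx => //; exact: measurable_trmx.
  - by move=> w _; rewrite lee_fin sqr_ge0.
  by rewrite row_second_momentE.
have h := subexponential_chernoff mrow rowsX.1 my y0 h1 h2 hw.
apply: le_trans h; rewrite le_eqVlt; apply/orP; left; apply/eqP.
congr (P _); apply/seteqP.
suff E w : (n%:R * w0 <= `|\sum_i (y (row i (X w)) - bil Sig u u / (8 * Q))|) =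
    (8 * Q * w0 <= `|bil (gram (X w) - Sig) u u|).
  by split => w /=; rewrite E.
have Q8 : 0 < 8 * Q by rewrite mulr_gt0.
have -> : \sum_i (y (row i (X w)) - bil Sig u u / (8 * Q)) =
    n%:R * (8 * Q)^-1 * bil (gram (X w) - Sig) u u.
  rewrite sumrB sumr_const card_ord -mulr_suml -[_ *+ n]mulr_natl bilBm.
  rewrite gram_form_mean; set S := \sum_i _.
  by field; rewrite !gt_eqF.
rewrite normrM gtr0_norm ?mulr_gt0 ?invr_gt0 // -[n%:R * _ * _]mulrA ler_pM2l //.
by rewrite ler_pdivlMl.
Qed.

(* The vectors f j + f k and f j - f k have second moment at most 4 M, and the
   factor 424 = 4 * 106 comes from row_second_moment. *)
Lemma gram_union_bound (J : finType) (f : J -> 'cV[R]_p) M w0 :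
  0 < M -> (forall j, bil Sig (f j) (f j) <= M) -> 0 <= w0 <= K ->
  (P (\bigcup_(jk in [set: J * J])
      [set w | (4 * (424 * M) * w0 < `|bil (gram (X w) - Sig) (f jk.1) (f jk.2)|)%R]) <=
   (4 * (#|J| ^ 2)%:R * expR (- (n%:R * w0 ^+ 2 / (4 * K))))%:E)%E.
Proof.
move=> M0 hM hw; set Q := 424 * M; set b := expR _.
have Q0 : 0 < Q by rewrite mulr_gt0 ?ltr0n.
have mA u v c : measurable [set w | c < `|bil (gram (X w) - Sig) u v|].
  under eq_set do rewrite bilBm.
  rewrite -[X in measurable X]setTI.
  apply: (measurable_fun_ltr (f := cst c)
    (g := fun w => `|bil (gram (X w)) u v - bil Sig u v|) _ _ measurableT
    (Y := [set true])) => //.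
  apply: measurableT_comp => //; apply: measurable_funB => //.
  exact: measurable_bil_gram.
have mB u c : measurable [set w | c <= `|bil (gram (X w) - Sig) u u|].
  under eq_set do rewrite bilBm.
  rewrite -[X in measurable X]setTI.
  apply: (measurable_fun_ler (f := cst c)
    (g := fun w => `|bil (gram (X w)) u u - bil Sig u u|) _ _ measurableT
    (Y := [set true])) => //.
  apply: measurableT_comp => //; apply: measurable_funB => //.
  exact: measurable_bil_gram.
rewrite (_ : 4 * _ * b = #|{: J * J}|%:R * (4 * b)); last first.
  by rewrite card_prod mulnn; ring.
apply: union_bound => [jk|[j k] /=]; first exact: mA.
have hD : bil Sig (f j + f k) (f j + f k) + bil Sig (f j - f k) (f j - f k) <= 4 * M.
  rewrite !(bilDl, bilDr, bilNl, bilNr) (bilC (f k) (f j) trmx_inner_product).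
  by have := hM j; have := hM k; lra.
have [hp hm] : 106 * bil Sig (f j + f k) (f j + f k) <= Q /\
    106 * bil Sig (f j - f k) (f j - f k) <= Q.
  have := inner_product_ge0 (f j + f k); have := inner_product_ge0 (f j - f k).
  by rewrite /Q => ? ?; split; lra.
apply: (@le_trans _ _ (P (
  [set w | 8 * Q * w0 <= `|bil (gram (X w) - Sig) (f j + f k) (f j + f k)|] `|`
  [set w | 8 * Q * w0 <= `|bil (gram (X w) - Sig) (f j - f k) (f j - f k)|]))).
  apply: le_measure; rewrite ?inE //; first exact: measurableU.
  (* If both deviations are below [8 * Q * w0], a quarter of their difference is below
     [4 * Q * w0]. *)
  move=> w /=; rewrite bil_polar; last by rewrite linearB /= trmx_gram trmx_inner_product.
  set D1 := bil _ _ _; set D2 := bil _ _ _ => h.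
  apply/orP; rewrite -[_ || _]negbK negb_or -!ltNge; apply/negP => /andP[h1 h2].
  move: h; rewrite ltNge => /negP; apply.
  rewrite normrM [X in _ * X]ger0_norm //; have := ler_normB D1 D2.
  by move: h1 h2; lra.
apply: le_trans (measureU2 _ _ _) _ => //.
rewrite (_ : 4 * b = 2 * b + 2 * b); last by ring.
by rewrite EFinD; apply: leeD; exact: gram_form_deviation.
Qed.

End gram_concentration.

(** * Conditional law of the Gaussian noise *)

Section image_kernel.
Context {R : realType} {d1 d2 de : measure_display} {T1 : measurableType d1}
  {T2 : measurableType d2} {Te : measurableType de} (Pe : probability Te R)
  (g : T1 * Te -> T2).

(** The law of [g (x, e)] with [x] frozen and [e] distributed as [Pe]. Under independence it is a
    regular conditional distribution, given explicitly at every [x]. *)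
Definition image_kernel (mg : measurable_fun setT g) (x : T1) :
    {measure set T2 -> \bar R} :=
  distribution Pe (HB.pack (fun e => g (x, e))
    (isMeasurableFun.Build _ _ _ _ _ (measurable_fun_pair2 x mg)) : {RV Pe >-> T2}).

Variable mg : measurable_fun setT g.

Let measurable_image_kernel U : measurable U ->
  measurable_fun setT (image_kernel mg ^~ U).
Proof.
move=> mU; have mgU : measurable (g @^-1` U).
  by rewrite -[X in measurable X]setTI; exact: mg.
have := measurable_fun_xsection Pe mgU; congr (measurable_fun _ _).
by apply/funext => x /=; rewrite xsectionE.
Qed.

HB.instance Definition _ :=
  isKernel.Build _ _ _ _ _ (image_kernel mg) measurable_image_kernel.

Let image_kernel_setT x : image_kernel mg x setT = 1%E.
Proof. exact: probability_setT. Qed.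

HB.instance Definition _ :=
  Kernel_isProbability.Build _ _ _ _ _ (image_kernel mg) image_kernel_setT.

End image_kernel.

Section conditional_law.
Context {R : realType} {d d1 d2 d3 : measure_display} {T : measurableType d}
  {T1 : measurableType d1} {T2 : measurableType d2} {T3 : measurableType d3}
  (P : probability T R) (X : {RV P >-> T1}) (Y : {RV P >-> T2}) (g : T1 * T2 -> T3)
  (mg : measurable_fun setT g).

Lemma conditional_distribution_image : independent_rv P X Y ->
  conditional_distribution P X (fun w => g (X w, Y w))
    (image_kernel (distribution P Y) mg).
Proof.
move=> indep A B mA mB.
have mE : measurable ((A `*` setT) `&` g @^-1` B).
  apply: measurableI; first exact: measurableX.
  by rewrite -[X in measurable X]setTI; exact: mg.
transitivity (P [set w | ((A `*` setT) `&` g @^-1` B) (X w, Y w)]).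
  by congr (P _); apply/seteqP; split => w /=; tauto.
rewrite independent_joint // [RHS]integral_mkcond; apply: eq_integral => w _.
rewrite patchE; case: ifPn => [|] wA.
  congr (distribution P Y _); apply/seteqP; split => e.
    by rewrite xsectionE => -[].
  by rewrite xsectionE /= => ?; split => //; move: wA; rewrite inE.
rewrite (_ : xsection _ _ = set0) ?measure0 //.
apply/seteqP; split => e //; rewrite xsectionE /= => -[[? _] _].
by move: wA; rewrite notin_setE.
Qed.

End conditional_law.

Section noise.
Context {R : realType} {d : measure_display} {T : measurableType d}
  (P : probability T R) {n p : nat}.
Variables (X : {RV P >-> 'M[R]_(n, p)}) (eps : {RV P >-> 'cV[R]_n}) (sigma : R).
Hypotheses (n0 : (0 < n)%N)
  (geps : is_gaussian (distribution P eps) 0 (sigma ^+ 2)%:M)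
  (indep : independent_rv P X eps).

Let n0R : 0 < n%:R :> R. Proof. by rewrite ltr0n. Qed.

(** A linear form [t] of [A *m e] is the linear form [t *m A] of [e]. Describing [nu] by its values
    allows it to be a kernel at a fixed design. *)
Lemma is_gaussian_image q (A : 'M[R]_(q, n)) (nu : set 'cV[R]_q -> \bar R) :
  (forall B, measurable B -> nu B = distribution P eps [set e | B (A *m e)]) ->
  is_gaussian nu 0 (sigma ^+ 2 *: (A *m A^T)).
Proof.
move=> hnu; have [_ pos law] := geps.
have vE (t : 'rV[R]_q) : t *m (sigma ^+ 2 *: (A *m A^T)) *m t^T =
    (t *m A) *m (sigma ^+ 2)%:M *m (t *m A)^T.
  by rewrite mul_mx_scalar -scalemxAr -!scalemxAl trmx_mul !mulmxA.
split.
- by rewrite linearZ /= trmx_mul trmxK.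
- by move=> t; rewrite vE; exact: pos.
- move=> t B mB; rewrite vE mulmx0.
  have mtB : measurable [set x : 'cV[R]_q | B ((t *m x) 0 0)].
    rewrite -[X in measurable X]setTI.
    apply: (measurable_mxcoord (f := fun x : 'cV[R]_q => t *m x)) => //.
    exact: measurable_mulmx.
  have := law (t *m A) B mB; rewrite mulmx0 => <-.
  rewrite /pushforward hnu //; congr (distribution P eps _).
  by apply/seteqP; split => e /=; rewrite mulmxA.
Qed.

(** For a frozen design the coordinate [j] of [x^T *m eps] is centred Gaussian with variance
    [sigma ^+ 2 * n * gram x j j]. Having [gram x j j <= M] inside the event caps this variance
    before the design is integrated out. *)
Lemma noise_bound S M u : sigma ^+ 2 <= S -> 0 < S -> 0 < M -> 0 <= u ->
  (P (\bigcup_(j in [set: 'I_p])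
      [set w | (gram (X w) j j <= M)%R /\
         (u < `|((X w)^T *m eps w) j 0 / n%:R|)%R]) <=
   (p%:R * (2 * expR (- (n%:R * u ^+ 2 / (8 * S * M)))))%:E)%E.
Proof.
move=> hS S0 M0 u0; set b := 2 * expR _.
have b0 : 0 <= b by rewrite mulr_ge0 ?expR_ge0.
have mX : measurable_fun setT X := measurable_funPT X.
have meps : measurable_fun setT eps := measurable_funPT eps.
pose A j := [set xe : 'M[R]_(n, p) * 'cV[R]_n |
  gram xe.1 j j <= M /\ u < `|(xe.1^T *m xe.2) j 0 / n%:R|].
have mA j : measurable (A j).
  apply: measurableI.
    rewrite -[X in measurable X]setTI.
    apply: (measurable_fun_ler (f := fun xe : 'M[R]_(n, p) * 'cV[R]_n => gram xe.1 j j)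
      (g := cst M) _ _ measurableT (Y := [set true])) => //.
    apply: (measurable_mxcoord (f := fun xe : 'M[R]_(n, p) * 'cV[R]_n => gram xe.1)).
    by apply: measurable_scalemx; apply: measurable_mulmx => //; exact: measurable_trmx.
  rewrite -[X in measurable X]setTI.
  apply: (measurable_fun_ltr (f := cst u)
    (g := fun xe : 'M[R]_(n, p) * 'cV[R]_n => `|(xe.1^T *m xe.2) j 0 / n%:R|)
    _ _ measurableT (Y := [set true])) => //.
  apply: measurableT_comp => //; apply: measurable_funM => //.
  apply: (measurable_mxcoord (f := fun xe : 'M[R]_(n, p) * 'cV[R]_n => xe.1^T *m xe.2)).
  by apply: measurable_mulmx => //; exact: measurable_trmx.
rewrite (_ : p%:R * b = #|'I_p|%:R * b); last by rewrite card_ord.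
 apply: union_bound => [j|j].
  have mXe : measurable_fun setT (fun w => (X w, eps w)) by exact: measurable_fun_pair.
  rewrite [X in measurable X](_ : _ = (fun w => (X w, eps w)) @^-1` A j) //.
  by rewrite -[X in measurable X]setTI; exact: mXe.
rewrite [X in P X](_ : _ = [set w | A j (X w, eps w)]) //.
rewrite independent_joint //.
apply: (@le_trans _ _ (\int[P]_w b%:E)%E); last first.
  by rewrite integral_cst //= probability_setT mule1.
apply: ge0_le_integral => //.
  by apply: (measurableT_comp (measurable_fun_xsection (distribution P eps) (mA j))).
move=> w _; set x := X w; have [xM|xM] := leP (gram x j j) M; last first.
  rewrite (_ : xsection _ _ = set0) ?measure0 ?lee_fin //.
  by apply/seteqP; split => e //; rewrite xsectionE /= => -[]; rewrite leNgt xM.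
pose z w' := ((col j x)^T *m eps w') 0 0.
have mz : measurable_fun setT z.
  apply: (measurable_mxcoord (f := fun w' => (col j x)^T *m eps w')).
  exact: measurable_mulmx.
have zE w' : (x^T *m eps w') j 0 = z w' by rewrite /z tr_col -row_mul !mxE.
pose v := sigma ^+ 2 * (n%:R * gram x j j).
have vE : ((col j x)^T *m (sigma ^+ 2)%:M *m (col j x)^T^T) 0 0 = v.
  rewrite mul_mx_scalar -scalemxAl mxE trmxK -dot_mx dot_sqnorm2 /v.
  by rewrite -bil_delta bil_gram -colE dot_sqnorm2 [n%:R * _]mulrC divfK ?gt_eqF.
have G0 : 0 <= gram x j j.
  by rewrite -bil_delta bil_gram dot_sqnorm2 divr_ge0 ?sqnorm2_ge0.
have vV : 0 <= v <= S * (n%:R * M).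
  rewrite /v mulr_ge0 ?sqr_ge0 ?mulr_ge0 //=.
  by apply: ler_pM; rewrite ?sqr_ge0 ?mulr_ge0 // ler_wpM2l.
have V0 : 0 < S * (n%:R * M) by rewrite !mulr_gt0.
have nu0 : 0 <= n%:R * u by rewrite mulr_ge0.
apply: (@le_trans _ _ (P [set w' | (n%:R * u <= `|z w'|)%R])).
  apply: (@le_measure _ _ _ P (eps @^-1` _)); rewrite ?inE.
  - by apply: measurable_funPTI; exact: measurable_xsection.
  - rewrite -[X in measurable X]setTI.
    apply: (measurable_fun_ler (f := cst (n%:R * u)) (g := fun w' => `|z w'|)
      _ _ measurableT (Y := [set true])) => //.
    exact: measurableT_comp.
  move=> w' /=; rewrite xsectionE => -[_ /=]; rewrite zE.
  rewrite normrM [`|n%:R^-1|]ger0_norm ?invr_ge0 // ltr_pdivlMr // mulrC.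
  exact: ltW.
apply: le_trans (normal_law_tail mz vV V0 nu0 _) _.
  move=> B mB; have [_ _ law] := geps.
  by have := law (col j x)^T B mB; rewrite vE mulmx0 mxE => <-.
rewrite lee_fin le_eqVlt; apply/orP; left; apply/eqP; rewrite /b.
congr (_ * expR (- _)); field; rewrite !gt_eqF //.
Qed.

End noise.

(** * Finite-sample bounds *)

Section measurable_estimator.
Context {R : realType} {n p : nat}.
Variables (lambda : 'I_p -> R) (g : 'M[R]_(n, p) -> 'I_p -> 'cV[R]_p.-1).
Hypothesis mg : forall j, measurable_fun setT (fun x => g x j).

Lemma measurable_nodewise_dir j : measurable_fun setT (fun x => nodewise_dir j (g x j)).
Proof.
apply: measurable_mx => k l; under eq_fun do rewrite mxE.
case: (unlift j k) => [k'|]; last exact: measurable_cst.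
by apply: measurableT_comp => //; exact: measurable_mxcoord.
Qed.

Lemma measurable_tau2 j : measurable_fun setT (fun x => tau2 lambda x (g x) j).
Proof.
rewrite /tau2; apply: measurable_funD.
  apply: measurable_funM => //; rewrite /sqnorm2.
  apply: measurable_sum => i; apply: measurable_funX.
  under eq_fun do rewrite -mulmx_nodewise_dir.
  apply: (measurable_mxcoord (f := fun x => x *m nodewise_dir j (g x j))).
  by apply: measurable_mulmx => //; exact: measurable_nodewise_dir.
apply: measurable_funM => //; rewrite /norm1.
apply: measurable_sum => k; apply: measurableT_comp => //.
exact: measurable_mxcoord.
Qed.

Lemma measurable_Theta_lasso :
  measurable_fun setT (fun x => Theta_lasso lambda x (g x)).
Proof.
apply: measurable_mx => j k; under eq_fun do rewrite Theta_lassoE.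
apply: measurable_funM; last first.
  by apply: measurable_mxcoord; exact: measurable_nodewise_dir.
apply: measurable_fun_ifT; last 2 first.
- by apply: measurable_funV; exact: measurable_tau2.
- exact: measurable_tau2.
apply: (measurable_fun_bool true); rewrite setTI.
rewrite [X in measurable X](_ : _ = \bigcap_(i in [set: 'I_p])
    [set x | tau2 lambda x (g x) i != 0]); last first.
  apply/seteqP; split => x /= => [/forallP h i _|h]; first exact: h.
  by apply/forallP => i; exact: h.
apply: fin_bigcap_measurable => // i _.
have := measurable_fun_eqr (measurable_tau2 i) (@measurable_cst _ _ _ _ setT (0 : R)).
move=> /(_ measurableT [set false]); rewrite setTI; move=> /(_ I).
by congr (measurable _); apply/seteqP; split => x /=; case: eqP.
Qed.

Lemma measurable_Omega_hat :
  measurable_fun setT (fun x => Omega_hat (Theta_lasso lambda x (g x)) x).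
Proof.
have mT := measurable_Theta_lasso.
apply: measurable_mulmx; last exact: measurable_trmx.
apply: measurable_mulmx => //; apply: measurable_scalemx.
by apply: measurable_mulmx => //; exact: measurable_trmx.
Qed.

End measurable_estimator.

Section finite_sample.
Context {R : realType} {n p : nat}.
Variables (Sig : 'M[R]_p) (L M kappa e l : R).
Hypotheses (n0 : (0 < n)%N) (symS : Sig^T = Sig) (L0 : 0 < L)
  (hL : forall v, L * sqnorm2 v <= bil Sig v v) (hM : forall j, Sig j j <= M).
Hypotheses (e0 : 0 < e) (e1 : e <= 1) (eL : 5 * e <= L / 2)
  (k0 : 0 <= kappa) (kl : 2 * kappa <= l) (ke : kappa <= e ^+ 2).

(** A single family, so that one union bound over its pairs yields the entrywise bound, the nodewise
    scores and the Gram matrix of the population residuals. *)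
Definition direction (a : 'I_p + 'I_p) : 'cV[R]_p :=
  match a with inl j => delta_mx j 0 | inr j => pop_dir Sig j end.

Lemma bil_direction_le a : bil Sig (direction a) (direction a) <= M.
Proof.
case: a => j /=; first by rewrite bil_delta.
by rewrite (bil_pop_dir_self L0 hL) (pop_tau2_le symS L0 hL hM).
Qed.

Variables (x : 'M[R]_(n, p)) (gamma : 'I_p -> 'cV[R]_p.-1).
Hypotheses (hgamma : is_nodewise_lasso (fun=> l) x gamma)
  (hsp : forall j, 9 * l ^+ 2 * (row_sparsity (invmx Sig) j)%:R * (M / L) <= e ^+ 4)
  (good : forall a b, `|bil (gram x - Sig) (direction a) (direction b)| <= kappa).

Let Th := Theta_lasso (fun=> l) x gamma.

Let l_ge0 : 0 <= l.
Proof. by apply: le_trans kl; rewrite mulr_ge0. Qed.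

Let hrho j : 3 * (l * norm1 (pop_gamma Sig j)) <= e ^+ 2.
Proof.
rewrite -ler_sqr ?nnegrE ?sqr_ge0 ?mulr_ge0 ?norm1_ge0 // -exprM.
apply: le_trans (hsp j).
have := norm1_pop_gamma symS L0 hL hM j.
have -> : (3 * (l * norm1 (pop_gamma Sig j))) ^+ 2 =
  9 * l ^+ 2 * norm1 (pop_gamma Sig j) ^+ 2 by ring.
by move=> h; rewrite -[leRHS]mulrA ler_wpM2l // mulr_ge0 ?sqr_ge0.
Qed.

Lemma Omega_hat_close eta : 0 < eta ->
  e * ((M + 4) + 15 * M ^+ 2 / L ^+ 2) * 4 / L ^+ 2 <= eta ->
  `|Omega_hat Th x - invmx Sig| <= eta.
Proof.
move=> eta0 he; rewrite [leLHS]mx_normrE; apply/bigmax_leP; split; first exact: ltW.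
move=> [j k] _ /=; apply: le_trans he.
apply: (Omega_hat_dist symS L0 hL hM _ hgamma e0 e1 (kappa := kappa)) => //.
- by move=> a b; exact: (good (inr a) (inr b)).
- by move=> a b; exact: (good (inl b) (inr a)).
Qed.

Lemma Delta_close (lambda eta : R) (s : nat) (eps : 'cV[R]_n) (beta0 b : 'cV[R]_p) :
  let Delta := - Num.sqrt n%:R *: ((Th *m gram x - 1%:M) *m (b - beta0)) in
  0 < lambda -> 0 < eta -> sparse_ball s beta0 ->
  is_lasso lambda x (x *m beta0 + eps) b ->
  (forall j, `|(x^T *m eps) j 0 / n%:R| <= lambda / 2) ->
  16 * kappa * s%:R <= L / 2 ->
  Num.sqrt n%:R * (2 * l / L) * (24 * lambda * s%:R / L) <= eta ->
  `|Delta| <= eta.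
Proof.
move=> Delta la0 eta0 sb hb heps hs hle.
rewrite [leLHS]mx_normrE; apply/bigmax_leP; split; first exact: ltW.
move=> [j k] _ /=; rewrite ord1 mxE normrM normrN [X in X * _]ger0_norm ?sqrtr_ge0 //.
apply: le_trans hle; rewrite -[leRHS]mulrA ler_wpM2l ?sqrtr_ge0 //.
have hd : norm1 (b - beta0) <= 24 * lambda * s%:R / L.
  apply: (lasso_l1_error (Sig := Sig) (kappa := kappa) la0 L0 k0 hb) => //.
    by move=> i; rewrite addrC addKr.
  by move=> i i'; have := good (inl i) (inl i'); rewrite bil_delta.
have hT i i' : `|(Th *m gram x - 1%:M) i i'| <= 2 * l / L.
  apply: (Theta_lasso_gram_dist L0 hL _ hgamma e0 e1 (kappa := kappa)) => //.
  - by move=> a a'; exact: (good (inr a) (inr a')).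
  - by move=> a a'; exact: (good (inl a') (inr a)).
apply: (@le_trans _ _ (2 * l / L * norm1 (b - beta0))).
  rewrite [X in `|X|](_ : _ = dot (row j (Th *m gram x - 1%:M))^T (b - beta0)).
    by apply: dot_le_norm1 => i; rewrite mxE mxE hT.
  by rewrite dot_mx trmxK -row_mul [RHS]mxE.
by rewrite ler_wpM2l // divr_ge0 ?mulr_ge0 // ltW.
Qed.

Lemma desparsified_decomposition (eps : 'cV[R]_n) (beta0 b : 'cV[R]_p) (Theta : 'M[R]_p) :
  Num.sqrt n%:R *: (desparsified Theta x (x *m beta0 + eps) b - beta0) =
  ((Num.sqrt n%:R / n%:R) *: (Theta *m x^T)) *m eps +
  - Num.sqrt n%:R *: ((Theta *m gram x - 1%:M) *m (b - beta0)).
Proof.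
rewrite /desparsified /gram; have -> : x *m beta0 + eps - x *m b = eps - x *m (b - beta0).
  by rewrite mulmxBr opprB addrCA addrA.
rewrite -[_ *: _ *m eps]scalemxAl mulmxBr mulmxBl mul1mx -scalemxAr -scalemxAl.
rewrite !mulmxA; set t1 := Theta *m x^T *m eps; set t2 := _ *m (b - beta0).
by apply/colP => j; rewrite !mxE; ring.
Qed.

End finite_sample.

(** * Probabilities of the exceptional events *)

Section probability_bounds.
Context {R : realType} {d : measure_display} {T : measurableType d}
  (P : probability T R) {n p : nat}.
Variables (X : {RV P >-> 'M[R]_(n, p)}) (L M w0 e l : R).
Let Sig := inner_product_mx P X.
Let K : R := 32 * expR 1.
Let kappa := 4 * (424 * M) * w0.
Hypotheses (n0 : (0 < n)%N) (rowsX : iid_gaussian_rows P X) (L0 : 0 < L) (M0 : 0 < M)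
  (hL : forall v, L * sqnorm2 v <= bil Sig v v) (hM : forall j, Sig j j <= M).
Hypotheses (e0 : 0 < e) (e1 : e <= 1) (eL : 5 * e <= L / 2)
  (hw : 0 <= w0 <= K) (kl : 2 * kappa <= l) (ke : kappa <= e ^+ 2)
  (hsp : forall j, 9 * l ^+ 2 * (row_sparsity (invmx Sig) j)%:R * (M / L) <= e ^+ 4).
Variable ghat : 'M[R]_(n, p) -> 'I_p -> 'cV[R]_p.-1.
Hypotheses (mghat : forall j, measurable_fun setT (fun x => ghat x j))
  (hghat : forall x, is_nodewise_lasso (fun=> l) x (ghat x)).

Let mX : measurable_fun setT X := measurable_funPT X.
Let Th x := Theta_lasso (fun=> l) x (ghat x).
Let symS : Sig^T = Sig := trmx_inner_product n0 rowsX.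

Let k0 : 0 <= kappa.
Proof. by move: hw => /andP[? _]; rewrite mulr_ge0 ?mulr_ge0 ?ler0n ?(ltW M0). Qed.

Definition gram_bad : set T :=
  \bigcup_(jk in [set: ('I_p + 'I_p) * ('I_p + 'I_p)])
      [set w | kappa < `|bil (gram (X w) - Sig) (direction Sig jk.1) (direction Sig jk.2)|].

(** There are [2 * p] directions, and [4 * (2 * p) ^ 2 = 16 * p ^ 2]. *)
Let gram_bad_prob :
  (P gram_bad <= (16 * p%:R ^+ 2 * expR (- (n%:R * w0 ^+ 2 / (4 * K))))%:E)%E.
Proof.
have := @gram_union_bound _ _ _ P _ _ X n0 rowsX _ (direction Sig) M w0 M0 _ hw.
move=> h; apply: le_trans (h _) _ => [j|]; first exact: (bil_direction_le symS L0 hL hM).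
rewrite lee_fin card_sum !card_ord natrX natrD le_eqVlt; apply/orP; left; apply/eqP.
by rewrite /K; ring.
Qed.

Let measurable_gram_bad : measurable gram_bad.
Proof.
apply: fin_bigcup_measurable; first exact: finite_finset.
move=> jk _; under eq_set do rewrite bilBm.
rewrite -[X in measurable X]setTI.
apply: (measurable_fun_ltr (f := cst kappa)
  (g := fun w => `|bil (gram (X w)) (direction Sig jk.1) (direction Sig jk.2) -
     bil Sig (direction Sig jk.1) (direction Sig jk.2)|) _ _ measurableT
  (Y := [set true])) => //.
apply: measurableT_comp => //; apply: measurable_funB => //.
exact: measurable_bil_gram.
Qed.

Let gram_good w : ~ gram_bad w -> forall a b,
  `|bil (gram (X w) - Sig) (direction Sig a) (direction Sig b)| <= kappa.
Proof.
by move=> nb a b; rewrite leNgt; apply/negP => h; apply: nb; exists (a, b).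
Qed.

Lemma Omega_hat_prob eta : 0 < eta ->
  e * ((M + 4) + 15 * M ^+ 2 / L ^+ 2) * 4 / L ^+ 2 <= eta ->
  (P [set w | (eta < `|Omega_hat (Th (X w)) (X w) - invmx Sig|)%R] <=
    (16 * p%:R ^+ 2 * expR (- (n%:R * w0 ^+ 2 / (4 * K))))%:E)%E.
Proof.
move=> eta0 he; apply: le_trans gram_bad_prob.
apply: le_measure; rewrite ?inE.
- apply: measurable_lt_mx_norm => //; apply: measurable_addmx => //.
  exact: (measurableT_comp (measurable_Omega_hat (fun=> l) mghat) mX).
- exact: measurable_gram_bad.
move=> w /= h; apply: contrapT => nb; move: h; apply/negP; rewrite -leNgt.
exact: (Omega_hat_close symS L0 hL hM e0 e1 eL k0 kl ke (hghat _) hsp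
  (gram_good nb) eta0 he).
Qed.

Variables (eps : {RV P >-> 'cV[R]_n}) (sigma S u lambda : R).
Hypotheses (geps : is_gaussian (distribution P eps) 0 (sigma ^+ 2)%:M)
  (indep : independent_rv P X eps) (hS : sigma ^+ 2 <= S) (S0 : 0 < S)
  (u0 : 0 <= u) (ul : 2 * u <= lambda) (lambda0 : 0 < lambda) (kM : kappa <= M).
Variable bhat : 'M[R]_(n, p) * 'cV[R]_n -> 'cV[R]_p.
Hypotheses (mbhat : measurable_fun setT bhat)
  (hbhat : forall x y, is_lasso lambda x y (bhat (x, y))).

(** The exceptional events involve only the design and the noise, so the bound is free of [beta0];
    this is the source of the uniformity over the sparse ball. *)
Lemma Delta_prob (eta : R) (s : nat) (beta0 : 'cV[R]_p) :
  0 < eta -> sparse_ball s beta0 ->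
  16 * kappa * s%:R <= L / 2 ->
  Num.sqrt n%:R * (2 * l / L) * (24 * lambda * s%:R / L) <= eta ->
  (P [set w | (eta < `|- Num.sqrt n%:R *: ((Th (X w) *m gram (X w) - 1%:M) *m
        (bhat (X w, X w *m beta0 + eps w) - beta0))|)%R] <=
   (16 * p%:R ^+ 2 * expR (- (n%:R * w0 ^+ 2 / (4 * K))) +
    p%:R * (2 * expR (- (n%:R * u ^+ 2 / (8 * S * (2 * M))))))%:E)%E.
Proof.
move=> eta0 sb hs hle.
have meps : measurable_fun setT eps := measurable_funPT eps.
pose noise_bad := \bigcup_(j in [set: 'I_p])
      [set w | (gram (X w) j j <= 2 * M)%R /\
         (u < `|((X w)^T *m eps w) j 0 / n%:R|)%R].
have mnoise : measurable noise_bad.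
  apply: fin_bigcup_measurable; first exact: finite_finset.
  move=> j _; apply: measurableI.
    rewrite -[X in measurable X]setTI.
    apply: (measurable_fun_ler (f := fun w => gram (X w) j j)
      (g := cst (2 * M)) _ _ measurableT (Y := [set true])) => //.
    exact: (measurable_mxcoord (f := fun w => gram (X w)) j j (measurable_gram X)).
  rewrite -[X in measurable X]setTI.
  apply: (measurable_fun_ltr (f := cst u)
    (g := fun w => `|((X w)^T *m eps w) j 0 / n%:R|)
    _ _ measurableT (Y := [set true])) => //.
  apply: measurableT_comp => //; apply: measurable_funM => //.
  apply: (measurable_mxcoord (f := fun w => (X w)^T *m eps w)).
  by apply: measurable_mulmx => //; exact: measurable_trmx.
apply: (@le_trans _ _ (P (gram_bad `|` noise_bad))); last first.
  apply: le_trans (measureU2 _ _ _) _ => //.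
  rewrite EFinD; apply: leeD; first exact: gram_bad_prob.
  by apply: (noise_bound n0 geps indep) => //; rewrite mulr_gt0.
apply: le_measure; rewrite ?inE.
- apply: measurable_lt_mx_norm => //; apply: measurable_scalemx.
  apply: measurable_mulmx; apply: measurable_addmx => //.
    apply: measurable_mulmx; last exact: measurable_gram.
    exact: (measurableT_comp (measurable_Theta_lasso (fun=> l) mghat) mX).
  apply: (measurableT_comp mbhat); apply: measurable_fun_pair => //.
  by apply: measurable_addmx => //; exact: measurable_mulmx.
- exact: measurableU.
move=> w /= h; apply: contrapT => /not_orP[nb nn]; move: h; apply/negP; rewrite -leNgt.
have heps j : `|((X w)^T *m eps w) j 0 / n%:R| <= lambda / 2.
  (* Off [gram_bad] the truncation in [noise_bad] always holds, thanks to [kappa <= M]. *)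
  have Gj : gram (X w) j j <= 2 * M.
    have := gram_good nb (inl j) (inl j); rewrite bilBm !bil_delta ler_norml.
    by move=> /andP[_]; have := hM j; have := kM; lra.
  rewrite leNgt; apply/negP => h; apply: nn; exists j => //; split => //.
  by apply: le_lt_trans h; rewrite ler_pdivlMr // mulrC.
exact: (Delta_close symS L0 hL hM e0 e1 eL k0 kl ke (hghat _) hsp (gram_good nb)
  lambda0 eta0 sb (hbhat _ _) heps hs hle).
Qed.

End probability_bounds.

(** * Asymptotics *)

Section rates.
Context {R : realType}.

(** Keeps log p away from 0, so that a bound on s_0 log p / sqrt n also controls s_0 sqrt (log p /
    n). *)
Lemma ln_ge_half (p : nat) : (1 < p)%N -> 2^-1 <= ln p%:R :> R.
Proof.
move=> p1; rewrite -[X in X <= _]expRK ler_ln ?posrE ?expR_gt0 ?ltr0n ?(ltnW p1) //.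
have h : expR (2^-1 : R) * (1 - 2^-1) <= 1.
  rewrite -[leRHS](expR0 R) -(addrN 2^-1) expRD ler_pM2l ?expR_gt0 //.
  exact: expR_ge1Dx.
have : (2 : R) <= p%:R by rewrite ler_nat.
lra.
Qed.

Lemma expRN_ln (p k : nat) : (0 < p)%N ->
  expR (- (k%:R * ln p%:R)) = p%:R ^- k :> R.
Proof. by move=> p0; rewrite expRN expRM_natl lnK // posrE ltr0n. Qed.

Lemma cvg_inv_bound (h : nat -> \bar R) (n : nat -> nat) (c : R) :
  n @ \oo --> \oo -> (\forall i \near \oo, (0 <= h i <= (c / (n i)%:R)%:E)%E) ->
  h i @[i --> \oo] --> 0%E.
Proof.
move=> noo hh; apply: (squeeze_cvge hh); first exact: cvg_cst.
have nooR : (fun i => (n i)%:R : R) @ \oo --> +oo by apply/cvgrnyP.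
have nV : (fun i => ((n i)%:R : R)^-1) @ \oo --> (0 : R).
  apply/(gtr0_cvgV0 _).2 => //.
  by move/cvgryPgt : nooR; exact.
have := cvgM (cvg_cst c) nV; rewrite mulr0 => cV.
by apply: cvg_EFin; [near=> i|exact: cV].
Unshelve. all: by end_near. Qed.

Lemma bigO_bounded (f : nat -> R) :
  (f : nat -> R^o) =O_\oo (fun=> 1 : R^o) ->
  exists2 C : R, 0 < C & \forall i \near \oo, f i <= C.
Proof.
move=> /eqO_exP[C C0 fC]; exists C => //; apply: filterS fC => i.
by rewrite normr1 mulr1; apply: le_trans; exact: ler_norm.
Qed.

Lemma littleo_small (f g : nat -> R) (e : R) : 0 < e ->
  (forall i, 0 <= g i) -> (f : nat -> R^o) =o_\oo (g : nat -> R^o) ->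
  \forall i \near \oo, f i <= e * g i.
Proof.
move=> e0 g0 /eqoP/(_ e e0); apply: filterS => i.
by rewrite [X in _ * X]ger0_norm //; apply: le_trans; exact: ler_norm.
Qed.

Lemma noise_covariance n p (x : 'M[R]_(n, p)) (Theta : 'M[R]_p) : (0 < n)%N ->
  let A := (Num.sqrt n%:R / n%:R) *: (Theta *m x^T) in
  A *m A^T = Omega_hat Theta x.
Proof.
move=> n0 A; rewrite /A /Omega_hat /gram linearZ /= trmx_mul trmxK.
rewrite -scalemxAr -!scalemxAl scalerA -scalemxAr -scalemxAl !mulmxA; congr (_ *: _).
have nn : n%:R != 0 :> R by rewrite pnatr_eq0 -lt0n.
by rewrite mulf_div -expr2 sqr_sqrtr // invfM mulrA divff // mul1r.
Qed.

End rates.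

Theorem corollary2p1 (R : realType)
  (n p : nat -> nat)
  (d : nat -> measure_display)
  (T : forall i, measurableType (d i))
  (P : forall i, probability (T i) R)
  (X : forall i, {RV (P i) >-> 'M[R]_(n i, p i)})
  (eps : forall i, {RV (P i) >-> 'cV[R]_(n i)})
  (sigma : nat -> R)
  (Lmin2 : nat -> R)
  (s0 : nat -> nat) :
  let Sigma i : 'M[R]_(p i) := inner_product_mx (P i) (X i) in
  let Y i (beta0 : 'cV[R]_(p i)) w : 'cV[R]_(n i) :=
    X i w *m beta0 + eps i w in
  let rate i : R := Num.sqrt (ln (p i)%:R / (n i)%:R) in
  (* the sequence n -> oo, p > n, log p / n = o(1) *)
  (forall i, (0 < n i)%N) ->
  n @ \oo --> \oo ->
  (forall i, (n i < p i)%N) ->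
  (fun i => ln (p i)%:R / (n i)%:R : R^o) =o_\oo (fun=> 1 : R^o) ->
  (* Gaussian errors, independent of the design *)
  (forall i, is_gaussian (distribution (P i) (eps i)) 0 (sigma i ^+ 2)%:M) ->
  (forall i, independent_rv (P i) (X i) (eps i)) ->
  (fun i => sigma i ^+ 2 : R^o) =O_\oo (fun=> 1 : R^o) ->
  (* Gaussian design *)
  (forall i, iid_gaussian_rows (P i) (X i)) ->
  (forall i, smallest_eigenvalue (Sigma i) (Lmin2 i)) ->
  (forall i, 0 < Lmin2 i) ->
  (fun i => 1 / Lmin2 i : R^o) =O_\oo (fun=> 1 : R^o) ->
  (fun i => \big[Num.max/0]_(j < p i) Sigma i j j : R^o)
    =O_\oo (fun=> 1 : R^o) ->
  (* sparsity *)
  (fun i => (s0 i)%:R : R^o)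
    =o_\oo (fun i => Num.sqrt (n i)%:R / ln (p i)%:R : R^o) ->
  (fun i => (\max_(j < p i) row_sparsity (invmx (Sigma i)) j)%:R : R^o)
    =o_\oo (fun i => (n i)%:R / ln (p i)%:R : R^o) ->
  exists (lambda : nat -> R) (lambdaX : forall i, 'I_(p i) -> R),
    (exists c C : R, [/\ 0 < c, 0 < C,
       forall i, c * rate i <= lambda i <= C * rate i &
       forall i j, c * rate i <= lambdaX i j <= C * rate i]) /\
    forall (bhat : forall i, 'M[R]_(n i, p i) * 'cV[R]_(n i) -> 'cV[R]_(p i))
      (ghat : forall i, 'M[R]_(n i, p i) -> 'I_(p i) -> 'cV[R]_(p i).-1),
    (* lasso and nodewise lasso, as measurable functions of the data *)
    (forall i, measurable_fun setT (bhat i)) ->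
    (forall i j, measurable_fun setT (fun x => ghat i x j)) ->
    (forall i x y, is_lasso (lambda i) x y (bhat i (x, y))) ->
    (forall i x, is_nodewise_lasso (lambdaX i) x (ghat i x)) ->
    let Thetahat i x := Theta_lasso (lambdaX i) x (ghat i x) in
    let Omegahat i x := Omega_hat (Thetahat i x) x in
    let blasso i beta0 w :=
      desparsified (Thetahat i (X i w)) (X i w) (Y i beta0 w)
        (bhat i (X i w, Y i beta0 w)) in
    (exists W Delta : forall i, 'cV[R]_(p i) -> T i -> 'cV[R]_(p i),
       (forall i beta0, sparse_ball (s0 i) beta0 ->
          [/\ forall w, Num.sqrt (n i)%:R *: (blasso i beta0 w - beta0) =
                W i beta0 w + Delta i beta0 w,
              measurable_fun setT (W i beta0) &
              exists2 kappa : R.-pker 'M[R]_(n i, p i) ~> 'cV[R]_(p i),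
                conditional_distribution (P i) (X i) (W i beta0) kappa &
                forall x,
                  is_gaussian (kappa x) 0 (sigma i ^+ 2 *: Omegahat i x)]) /\
       (forall eta : R, 0 < eta ->
          ereal_sup [set P i [set w | eta < `|Delta i beta0 w|]
                    | beta0 in sparse_ball (s0 i)] @[i --> \oo] --> 0%E)) /\
    (forall eta : R, 0 < eta ->
       P i [set w | eta < `|Omegahat i (X i w) - invmx (Sigma i)|]
         @[i --> \oo] --> 0%E).
Proof.
move=> Sigma Y rate n0 noo np logn geps indep hsig rowsX hev Lpos hL hM hs0 hsj.
have [CL CL0 hCL] := bigO_bounded hL.
have [M M0 hMn] := bigO_bounded hM.
have [S S0 hS] := bigO_bounded hsig.
pose L := CL^-1.
have L0 : 0 < L by rewrite invr_gt0.
pose K : R := 32 * expR 1.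
have K0 : 0 < K by rewrite mulr_gt0 ?expR_gt0.
pose cw := Num.sqrt (12 * K).
have cw0 : 0 < cw by rewrite sqrtr_gt0 mulr_gt0.
pose cu := Num.sqrt (32 * S * M).
have cu0 : 0 < cu by rewrite sqrtr_gt0 !mulr_gt0.
pose A := 4 * (424 * M) * cw.
have c424 : 0 < 424 :> R by rewrite ltr0n.
have c4 : 0 < 4 :> R by rewrite ltr0n.
have A0 : 0 < A := mulr_gt0 (mulr_gt0 c4 (mulr_gt0 c424 M0)) cw0.
have p1 i : (1 < p i)%N by apply: leq_ltn_trans (np i); exact: n0.
have n0R i : 0 < (n i)%:R :> R by rewrite ltr0n.
pose Lp i : R := ln (p i)%:R.
have Lp_half i : 2^-1 <= Lp i := ln_ge_half (p1 i).
have Lp0 i : 0 < Lp i by apply: lt_le_trans (Lp_half i); rewrite invr_gt0.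
have rate2 i : rate i ^+ 2 = Lp i / (n i)%:R.
  by rewrite sqr_sqrtr // divr_ge0 ?ltW // Lp0.
have rate0 i : 0 < rate i by rewrite sqrtr_gt0 divr_gt0 //; exact: Lp0.
have sqrtn0 i : 0 < Num.sqrt (n i)%:R :> R by rewrite sqrtr_gt0.
have sqrtn2 i : Num.sqrt (n i)%:R ^+ 2 = (n i)%:R :> R by rewrite sqr_sqrtr // ltW.
have rate_small (dl : R) : 0 < dl -> \forall i \near \oo, rate i <= dl.
  move=> dl0.
  have := littleo_small (exprn_gt0 2 dl0) (fun=> ler01) logn.
  apply: filterS => i; rewrite mulr1 => h.
  by rewrite -ler_sqr ?nnegrE ?(ltW dl0) ?(ltW (rate0 i)) // rate2.
have s0_small (dl : R) : 0 < dl -> \forall i \near \oo,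
    (s0 i)%:R * rate i <= dl /\ Num.sqrt (n i)%:R * rate i ^+ 2 * (s0 i)%:R <= dl.
  move=> dl0; have d2 : 0 < dl / 2 by rewrite divr_gt0.
  have g0 i : 0 <= Num.sqrt (n i)%:R / ln (p i)%:R :> R.
    by rewrite divr_ge0 ?(ltW (Lp0 i)).
  have := littleo_small d2 g0 hs0; apply: filterS => i.
  rewrite -/(Lp i); set q := Num.sqrt _; set s := (s0 i)%:R; set r := rate i => h.
  have q0 : 0 < q := sqrtn0 i.
  have Lq : Lp i = (q * r) ^+ 2.
    by rewrite exprMn rate2 sqrtn2 mulrCA divff ?mulr1 // gt_eqF.
  have r0 : 0 < r := rate0 i.
  have s_ge0 : 0 <= s by [].
  have sL : s * Lp i <= dl / 2 * q.
    by move: h; rewrite mulrA ler_pdivlMr ?Lp0.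
  split.
    (* As [(q * r) ^+ 2] is log p, at least 1/2, inserting another factor [q * r] costs at most a
       factor 2, which the choice of [dl / 2] pays for. *)
    have qr : 1 <= 2 * (q * r).
      have := Lp_half i; rewrite Lq; have : 0 < q * r by rewrite mulr_gt0.
      nra.
    have sqr0 : 0 <= s * (q * r) by rewrite !mulr_ge0 // ltW.
    have h1 := ler_wpM2l sqr0 qr.
    move: sL; rewrite Lq => sL; rewrite -(ler_pM2r q0); lra.
  have dq := mulr_gt0 dl0 q0.
  move: sL; rewrite Lq => sL; rewrite -(ler_pM2r q0); lra.
have sj_small (dl : R) : 0 < dl -> \forall i \near \oo, forall j : 'I_(p i),
    rate i ^+ 2 * (row_sparsity (invmx (Sigma i)) j)%:R <= dl.
  move=> dl0; have g0 i : 0 <= (n i)%:R / ln (p i)%:R :> R.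
    by rewrite divr_ge0 ?(ltW (Lp0 i)).
  have := littleo_small dl0 g0 hsj; apply: filterS => i.
  move=> h j; rewrite rate2.
  have hj : (row_sparsity (invmx (Sigma i)) j)%:R <= dl * ((n i)%:R / Lp i).
    by apply: le_trans h; rewrite ler_nat (leq_bigmax j).
  have Ln0 : 0 <= Lp i / (n i)%:R by rewrite divr_ge0 // ltW // Lp0.
  have := ler_wpM2l Ln0 hj; rewrite -/(Lp i).
  have -> // : Lp i / (n i)%:R * (dl * ((n i)%:R / Lp i)) = dl.
  have [Ln nn] : Lp i != 0 /\ (n i)%:R != 0 :> R by rewrite !gt_eqF ?Lp0.
  by field; rewrite Ln nn.
have regular : \forall i \near \oo, [/\ sigma i ^+ 2 <= S,
    forall j, Sigma i j j <= M & forall v, L * sqnorm2 v <= bil (Sigma i) v v].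
  near=> i; split.
  - by near: i; exact: hS.
  - move=> j; have : \big[Num.max/0]_(j < p i) Sigma i j j <= M.
      by near: i; exact: hMn.
    by apply: le_trans; exact: (le_bigmax _ (fun j => Sigma i j j)).
  - move=> v; have : 1 / Lmin2 i <= CL by near: i; exact: hCL.
    rewrite div1r => h.
    have symS := trmx_inner_product (n0 i) (rowsX i).
    apply: le_trans (smallest_eigenvalue_le v symS (hev i)).
    by rewrite ler_wpM2r ?sqnorm2_ge0 // /L invf_ple ?posrE.
(* With w0 = cw * rate and u = cu * rate, the tails exp (- n w0^2 / (4 K)) and
   exp (- n u^2 / (16 S M)) equal p^-3 and p^-2, which absorbs the union bounds
   over O(p^2) and p events; A * rate is the resulting bound on G - Sigma. *)
exists (fun i => 2 * cu * rate i), (fun i _ => 2 * A * rate i); split.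
  exists (Num.min (2 * cu) (2 * A)), (Num.max (2 * cu) (2 * A)); split.
  - by rewrite lt_min !mulr_gt0.
  - by rewrite lt_max !mulr_gt0.
  - by move=> i; rewrite !ler_pM2r // ge_min le_max !lexx.
  - by move=> i j; rewrite !ler_pM2r // ge_min le_max !lexx !orbT.
move=> bhat ghat mbhat mghat hbhat hghat Thetahat Omegahat blasso.
pose w0 i := cw * rate i.
pose kap i := 4 * (424 * M) * w0 i.
have kapE i : kap i = A * rate i by rewrite /kap /w0 /A -[RHS]mulrA.
have kl i : 2 * kap i <= 2 * A * rate i by rewrite kapE -[leRHS]mulrA.
pose bd (e : R) := e * ((M + 4) + 15 * M ^+ 2 / L ^+ 2) * 4 / L ^+ 2.
have choose_e eta : 0 < eta ->
    exists e : R, [/\ 0 < e, e <= 1, 5 * e <= L / 2 & bd e <= eta].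
  move=> eta0; have bd1 : 0 < bd 1.
    by rewrite /bd mul1r divr_gt0 ?exprn_gt0 // mulr_gt0 // addr_gt0 ?addr_gt0
      ?divr_gt0 ?mulr_gt0 ?exprn_gt0.
  have bdE e : bd e = e * bd 1 by rewrite /bd; ring.
  exists (Num.min 1 (Num.min (L / 10) (eta / bd 1))); split.
  - by rewrite !lt_min ltr01 (divr_gt0 eta0 bd1) divr_gt0.
  - by rewrite ge_min lexx.
  - have : Num.min 1 (Num.min (L / 10) (eta / bd 1)) <= L / 10.
      by rewrite ge_min ge_min lexx orbT.
    lra.
  - by rewrite bdE -ler_pdivlMr // !ge_min lexx !orbT.
have regime (e : R) : 0 < e -> \forall i \near \oo,
    [/\ 0 <= w0 i <= K, kap i <= e ^+ 2, kap i <= M &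
      forall j, 9 * (2 * A * rate i) ^+ 2 *
        (row_sparsity (invmx (Sigma i)) j)%:R * (M / L) <= e ^+ 4].
  move=> e0.
  have c0 : 0 < 36 * A ^+ 2 * (M / L).
    by apply: mulr_gt0; [rewrite mulr_gt0 ?exprn_gt0|exact: divr_gt0].
  have sj := sj_small _ (divr_gt0 (exprn_gt0 4 e0) c0).
  near=> i; split.
  - rewrite /w0 mulr_ge0 ?(ltW cw0) ?(ltW (rate0 i)) //= mulrC -ler_pdivlMr //.
    by near: i; apply: rate_small; rewrite divr_gt0.
  - rewrite kapE mulrC -ler_pdivlMr //.
    by near: i; apply: rate_small; rewrite divr_gt0 ?exprn_gt0.
  - rewrite kapE mulrC -ler_pdivlMr //.
    by near: i; apply: rate_small; rewrite divr_gt0.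
  - have : forall j, rate i ^+ 2 * (row_sparsity (invmx (Sigma i)) j)%:R <=
        e ^+ 4 / (36 * A ^+ 2 * (M / L)).
      by near: i; exact: sj.
    move=> + j => /(_ j); rewrite ler_pdivlMr //; congr (_ <= _).
    ring.
(* The tail [p^-3] leaves [16 / p], and [n < p] turns this into a bound that vanishes with
   [1 / n]. *)
have gram_prob i : 16 * (p i)%:R ^+ 2 * expR (- ((n i)%:R * w0 i ^+ 2 / (4 * K))) <=
    16 / (n i)%:R.
  have -> : (n i)%:R * w0 i ^+ 2 / (4 * K) = 3%:R * Lp i.
    rewrite exprMn rate2 sqr_sqrtr ?mulr_ge0 ?(ltW K0) //.
    by field; rewrite !gt_eqF.
  rewrite expRN_ln ?(ltnW (p1 i)) //.
  have pp : 0 < (p i)%:R :> R by rewrite ltr0n (ltnW (p1 i)).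
  have -> : 16 * (p i)%:R ^+ 2 * (p i)%:R ^- 3 = 16 / (p i)%:R :> R.
    by field; rewrite gt_eqF.
  by rewrite ler_pM2l // lef_pV2 ?posrE // ler_nat ltnW.
have noise_prob i : (p i)%:R * (2 * expR (- ((n i)%:R * (cu * rate i) ^+ 2 /
    (8 * S * (2 * M))))) <= 2 / (n i)%:R.
  have -> : (n i)%:R * (cu * rate i) ^+ 2 / (8 * S * (2 * M)) = 2%:R * Lp i.
    rewrite exprMn rate2 sqr_sqrtr ?mulr_ge0 ?(ltW M0) ?(ltW S0) //.
    by field; rewrite !gt_eqF.
  rewrite expRN_ln ?(ltnW (p1 i)) //.
  have pp : 0 < (p i)%:R :> R by rewrite ltr0n (ltnW (p1 i)).
  have -> : (p i)%:R * (2 * (p i)%:R ^- 2) = 2 / (p i)%:R :> R.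
    by field; rewrite gt_eqF.
  by rewrite ler_pM2l // lef_pV2 ?posrE // ler_nat ltnW.
split; last first.
  move=> eta eta0; have [e [e0 e1 eL ebd]] := choose_e eta eta0.
  apply: (cvg_inv_bound (c := 16) noo); near=> i.
  have [hSi hMi hLi] : [/\ sigma i ^+ 2 <= S, forall j, Sigma i j j <= M &
      forall v, L * sqnorm2 v <= bil (Sigma i) v v] by near: i.
  have [wi ki kMi si] : [/\ 0 <= w0 i <= K, kap i <= e ^+ 2, kap i <= M &
      forall j, 9 * (2 * A * rate i) ^+ 2 *
        (row_sparsity (invmx (Sigma i)) j)%:R * (M / L) <= e ^+ 4].
    by near: i; exact: regime.
  rewrite measure_ge0 /=; apply: le_trans (_ : (16 * (p i)%:R ^+ 2 *
    expR (- ((n i)%:R * w0 i ^+ 2 / (4 * K))))%:E <= _)%E; last by rewrite lee_fin.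
  exact: (Omega_hat_prob (n0 i) (rowsX i) L0 M0 hLi hMi e0 e1 eL wi (kl i) ki si
    (mghat i) (hghat i) eta0 ebd).
pose noise_mx i (x : 'M[R]_(n i, p i)) : 'M[R]_(p i, n i) :=
  (Num.sqrt (n i)%:R / (n i)%:R) *: (Thetahat i x *m x^T).
exists (fun i beta0 w => noise_mx i (X i w) *m eps i w),
  (fun i beta0 w => - Num.sqrt (n i)%:R *: ((Thetahat i (X i w) *m gram (X i w) - 1%:M)
     *m (bhat i (X i w, Y i beta0 w) - beta0))).
split.
  move=> i beta0 _.
  have mT : measurable_fun setT (Thetahat i).
    exact: (measurable_Theta_lasso (fun=> 2 * A * rate i) (mghat i)).
  have mg : measurable_fun setT
      (fun xe : 'M[R]_(n i, p i) * 'cV[R]_(n i) => noise_mx i xe.1 *m xe.2).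
    apply: measurable_mulmx => //; apply: measurable_scalemx.
    apply: measurable_mulmx; first exact: (measurableT_comp mT measurable_fst).
    exact: measurable_trmx.
  split.
  - by move=> w; exact: desparsified_decomposition.
  - have mXe : measurable_fun setT (fun w => (X i w, eps i w)).
      by apply: measurable_fun_pair; exact: measurable_funPT.
    exact: (measurableT_comp mg mXe).
  - exists (image_kernel (distribution (P i) (eps i)) mg).
      exact: (conditional_distribution_image mg (indep i)).
    move=> x; rewrite /Omegahat -(noise_covariance x (Thetahat i x) (n0 i)).
    exact: (is_gaussian_image (geps i)).
(* Here [e] only has to keep each [tau2] above [L / 2], so the target 1 is arbitrary; the smallness
   of the remainder comes from [s0_small]. *)
move=> eta eta0; have [e [e0 e1 eL _]] := choose_e 1 ltr01.
(* Solving [16 * A * rate * s0 <= L / 2] gives the first threshold. The second solves the bound on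
   the remainder, whose constants multiply to [2 * 2 * 24 * 2 = 192]. *)
have c1 : 0 < L / (32 * A) by rewrite divr_gt0 // mulr_gt0.
have c2 : 0 < eta * L ^+ 2 / (192 * A * cu).
  by apply: divr_gt0; [rewrite mulr_gt0 ?exprn_gt0|rewrite !mulr_gt0].
have s01 := s0_small _ c1; have s02 := s0_small _ c2.
apply: (cvg_inv_bound (c := 18) noo); near=> i.
have [hSi hMi hLi] : [/\ sigma i ^+ 2 <= S, forall j, Sigma i j j <= M &
    forall v, L * sqnorm2 v <= bil (Sigma i) v v] by near: i.
have [wi ki kMi si] : [/\ 0 <= w0 i <= K, kap i <= e ^+ 2, kap i <= M &
    forall j, 9 * (2 * A * rate i) ^+ 2 *
      (row_sparsity (invmx (Sigma i)) j)%:R * (M / L) <= e ^+ 4].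
  by near: i; exact: regime.
have hs1 : 16 * kap i * (s0 i)%:R <= L / 2.
  have [+ _] : (s0 i)%:R * rate i <= L / (32 * A) /\
     Num.sqrt (n i)%:R * rate i ^+ 2 * (s0 i)%:R <= L / (32 * A) by near: i.
  rewrite ler_pdivlMr ?mulr_gt0 // kapE; lra.
have hs2 : Num.sqrt (n i)%:R * (2 * (2 * A * rate i) / L) *
    (24 * (2 * cu * rate i) * (s0 i)%:R / L) <= eta.
  have [_] : (s0 i)%:R * rate i <= eta * L ^+ 2 / (192 * A * cu) /\
     Num.sqrt (n i)%:R * rate i ^+ 2 * (s0 i)%:R <= eta * L ^+ 2 / (192 * A * cu)
    by near: i.
  have cA : 0 < 192 * A * cu by rewrite !mulr_gt0.
  have LL : 0 < L ^+ 2 by rewrite exprn_gt0.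
  rewrite ler_pdivlMr // -ler_pdivrMr //; apply: le_trans.
  rewrite le_eqVlt; apply/orP; left; apply/eqP.
  by field; rewrite gt_eqF.
apply/andP; split.
  (* The supremum is nonnegative because the zero vector lies in every sparse ball; over an empty
     set it would be [-oo]. *)
  apply: (le_trans (measure_ge0 (P i) [set w | eta < `|- Num.sqrt (n i)%:R *:
     ((Thetahat i (X i w) *m gram (X i w) - 1%:M)
     *m (bhat i (X i w, Y i 0 w) - 0))|])).
  apply: ereal_sup_ubound; exists 0 => //.
  rewrite /sparse_ball /= (_ : #|_| = 0%N) //.
  by apply: eq_card0 => j; rewrite inE mxE eqxx.
apply: ge_ereal_sup => _ [beta0 sb <-].
apply: le_trans (_ : (16 * (p i)%:R ^+ 2 * expR (- ((n i)%:R * w0 i ^+ 2 / (4 * K))) +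
   (p i)%:R * (2 * expR (- ((n i)%:R * (cu * rate i) ^+ 2 / (8 * S * (2 * M))))))%:E <= _)%E;
  last first.
  rewrite lee_fin; apply: le_trans (lerD (gram_prob i) (noise_prob i)) _.
  by rewrite -mulrDl -natrD.
have u0 : 0 <= cu * rate i by rewrite mulr_ge0 // ltW.
have ul : 2 * (cu * rate i) <= 2 * cu * rate i by rewrite mulrA.
have la0 : 0 < 2 * cu * rate i by rewrite !mulr_gt0.
exact: (Delta_prob (n0 i) (rowsX i) L0 M0 hLi hMi e0 e1 eL wi (kl i) ki si
  (mghat i) (hghat i) (geps i) (indep i) hSi S0 u0 ul la0 kMi (mbhat i) (hbhat i)
  eta0 sb hs1 hs2).
Unshelve. all: by end_near. Qed.
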